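(* For each integer $m\ge3$, let $\theta_m$ be the graph with two vertices $q^+,q^-$ and $m$ edges, each of which has $q^+$ and $q^-$ as its two endpoints. Then $\mathrm{NTC}(\{\theta_m\})=m\pi$.
   Context: Mappings $f$ of a finite graph $\Gamma$ into $\mathbb{R}^n$ are piecewise $C^2$: after adding finitely many degree-2 vertices, each edge is mapped as a regular $C^2$ arc up to its endpoints; $f$ need not be an embedding. Net total curvature: at a vertex $q$ of degree $d$ with unit tangent vectors $T_1,\dots,T_d\in S^{n-1}$ pointing into the edges ending at $q$, let $\chi_i:S^{n-1}\to\{\pm1\}$ be $-1$ where $\langle e,T_i\rangle>0$ and $+1$ where $\langle e,T_i\rangle<0$ (a.e.). Set $\mathrm{ntc}(q)=\pi$ times the average over $e\in S^{n-1}$ of $\big[\sum_{i=1}^d\chi_i(e)\big]^+$ (for $n=1$, the average over $S^0=\{\pm1\}$), and $\mathrm{NTC}(f)=\sum_q\mathrm{ntc}(q)+\int|\vec k|\,ds$, the sum over all vertices (including those of degree 2) and the integral of the curvature over the open $C^2$ edges. $\mathrm{NTC}(\{\Gamma\})$ is the infimum of $\mathrm{NTC}(f)$ over all mappings $f:\Gamma\to\mathbb{R}^n$ (all $n$). *)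

(* Defs.v *)
From HB Require Import structures.
From mathcomp Require Import all_boot all_order all_algebra.
From mathcomp Require Import all_classical all_reals all_analysis.

Set Implicit Arguments.
Unset Strict Implicit.
Unset Printing Implicit Defensive.

Import Order.TTheory GRing.Theory Num.Theory.
Import numFieldNormedType.Exports.

Local Open Scope classical_set_scope.
Local Open Scope ring_scope.

Section lebesgue_tuple.
Context (R : realType).
Local Notation rT := (measurableTypeR R).

Definition consp n (xv : rT * n.-tuple rT) : n.+1.-tuple rT :=
  [tuple of xv.1 :: xv.2].

Lemma measurable_consp n : measurable_fun setT (@consp n).
Proof. exact: measurable_cons. Qed.

Section step.
Context (n : nat) (mu : {sigma_finite_measure set (n.-tuple rT) -> \bar R}).

Definition lebesgue_step : set (n.+1.-tuple rT) -> \bar R :=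
  pushforward (@lebesgue_measure R \x mu)%E (@consp n).

Let step0 : lebesgue_step set0 = 0%E.
Proof. by rewrite /lebesgue_step /pushforward preimage_set0 measure0. Qed.

Let step_ge0 A : (0 <= lebesgue_step A)%E.
Proof. by rewrite /lebesgue_step /pushforward measure_ge0. Qed.

Let step_sigma_additive : semi_sigma_additive lebesgue_step.
Proof.
move=> F mF tF mUF; rewrite /lebesgue_step /pushforward preimage_bigcup.
have mc := @measurable_consp n.
apply: measure_semi_sigma_additive.
- by move=> k; rewrite -[X in measurable X]setTI; exact: mc.
- apply/trivIsetP => /= i j _ _ ij; rewrite -preimage_setI.
  by move/trivIsetP : tF => /(_ _ _ _ _ ij) ->//; rewrite preimage_set0.
- by rewrite -preimage_bigcup -[X in measurable X]setTI; exact: mc.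
Qed.

HB.instance Definition _ := isMeasure.Build _ _ _ lebesgue_step
  step0 step_ge0 step_sigma_additive.

Let step_sigma_finite : sigma_finite setT lebesgue_step.
Proof.
have /sigma_finiteP[F [FT Fnd Foo]] := sigma_finiteT (@lebesgue_measure R).
have /sigma_finiteP[G [GT Gnd Goo]] := sigma_finiteT mu.
pose H k := [set v : n.+1.-tuple rT | F k (thead v) /\ G k [tuple of behead v]].
have consH k : @consp n @^-1` (H k) = F k `*` G k.
  have bK (x : rT) (v : n.-tuple rT) : [tuple of behead [tuple of x :: v]] = v.
    exact/val_inj.
  by apply/seteqP; split => -[x v]; rewrite /H /consp /= theadE bK.
exists H.
  apply/esym/seteqP; split => // v _.
  have [i _ Fi] : (\bigcup_i F i) (thead v) by rewrite -FT.
  have [j _ Gj] : (\bigcup_i G i) [tuple of behead v] by rewrite -GT.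
  exists (maxn i j) => //; split.
    by apply: (subsetPset _ _ (Fnd _ _ (leq_maxl i j))).
  by apply: (subsetPset _ _ (Gnd _ _ (leq_maxr i j))).
move=> k; have [mF Fk] := Foo k; have [mG Gk] := Goo k; split.
  rewrite (_ : H k = ((fun v : n.+1.-tuple rT => tnth v ord0) @^-1` F k) `&`
     ((fun v : n.+1.-tuple rT => [tuple of behead v]) @^-1` G k))//.
  apply: measurableI.
    by rewrite -[X in measurable X]setTI; exact: measurable_tnth.
  by rewrite -[X in measurable X]setTI; exact: measurable_behead.
rewrite /lebesgue_step /pushforward consH product_measure1E//.
by rewrite lte_mul_pinfty// ge0_fin_numE.
Qed.

HB.instance Definition _ := Measure_isSigmaFinite.Build _ _ _ lebesgue_step
  step_sigma_finite.
End step.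

(* Lebesgue measure on R^n as an n-fold product. *)
Fixpoint lebesgue_tuple n : {sigma_finite_measure set (n.-tuple rT) -> \bar R} :=
  if n is n'.+1 then lebesgue_step (lebesgue_tuple n') else \d_[tuple].

End lebesgue_tuple.

Section euclidean.
Context (R : realType) (n : nat).
Implicit Types u v : 'rV[R]_n.

(* The library norm on matrices is the sup norm, hence [enorm]. *)
Definition dot u v : R := \sum_(i < n) u 0 i * v 0 i.
Definition enorm u : R := Num.sqrt (dot u u).
Definition unit_vec u : 'rV[R]_n := (enorm u)^-1 *: u.

Definition vec_of_tuple (x : n.-tuple (measurableTypeR R)) : 'rV[R]_n :=
  \row_i tnth x i.

Definition unit_ball : set (n.-tuple (measurableTypeR R)) :=
  [set x | enorm (vec_of_tuple x) <= 1].

(* Average of [g >= 0] over the sphere S^(n-1) for the normalized surface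
   measure: the area of a part A of the sphere is n times the volume of the
   cone over A, i.e. the set of the x in the unit ball with x/|x| in A. For
   n = 1 this is the average over {1, -1}. *)
Definition sphere_average (g : 'rV[R]_n -> R) : \bar R :=
  ((fine (lebesgue_tuple R n unit_ball))^-1%:E *
   \int[lebesgue_tuple R n]_(x in unit_ball)
     (g (unit_vec (vec_of_tuple x)))%:E)%E.

(* The value 0 on the null set where <e, T> = 0 is immaterial. *)
Definition chi (T e : 'rV[R]_n) : R := - Num.sg (dot e T).

Definition ntc (Ts : seq 'rV[R]_n) : \bar R :=
  (pi%:E * sphere_average (fun e => Num.max (\sum_(T <- Ts) chi T e) 0)%R)%E.

Implicit Types (c : R -> 'rV[R]_n) (a b t : R).

Definition class_C2 c : Prop :=
  [/\ forall t, derivable c t 1,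
      forall t, derivable (derive1 c) t 1
    & continuous (derive1 (derive1 c))].

(* C^2 up to the endpoints a and b: c extends to a C^2 curve beyond [a, b]. *)
Definition regular_C2_arc c a b : Prop :=
  exists2 g : R -> 'rV[R]_n, class_C2 g &
    forall t, a <= t <= b -> c t = g t /\ derive1 g t != 0.

(* Unit tangent vectors at c t, pointing into the arc after t, resp. into
   the arc before t. *)
Definition tangent_after c t : 'rV[R]_n :=
  unit_vec (lim (h^-1 *: (c (t + h) - c t) @[h --> 0^'+])).
Definition tangent_before c t : 'rV[R]_n :=
  unit_vec (lim (h^-1 *: (c (t - h) - c t) @[h --> 0^'+])).

(* The norm of the curvature vector k = dT/ds, in an arbitrary parameter. *)
Definition curvature c t : R :=
  enorm (derive1 (fun s => unit_vec (derive1 c s)) t) / enorm (derive1 c t).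

Definition total_curvature c a b : \bar R :=
  (\int[@lebesgue_measure R]_(t in `]a, b[)
     (curvature c t * enorm (derive1 c t))%:E)%E.

End euclidean.

(* Finite graphs; loops and multiple edges are allowed. The order of the two
   endpoints only serves to parametrize the edge by [0, 1]. *)
Record graph := Graph {
  vertex : finType;
  edge : finType;
  source : edge -> vertex;
  target : edge -> vertex }.

(* A piecewise C^2 mapping of G into R^n: the edge e is mapped by the
   restriction of [emap e] to [0, 1], and [cuts e] lists the parameters in
   ]0, 1[ of the degree-2 vertices added on e. *)
Record mapping (R : realType) (G : graph) (n : nat) := Mapping {
  vmap : vertex G -> 'rV[R]_n;
  emap : edge G -> R -> 'rV[R]_n;
  cuts : edge G -> seq R;
  emap_source : forall e, emap e 0 = vmap (source e);
  emap_target : forall e, emap e 1 = vmap (target e);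
  cuts_sorted : forall e, path <%R 0 (rcons (cuts e) 1);
  emap_C2 : forall e (a b : R), (a, b) \in zip (0 :: cuts e) (rcons (cuts e) 1) ->
    regular_C2_arc (emap e) a b }.

Section net_total_curvature.
Context (R : realType) (G : graph).

Definition pieces n (f : mapping R G n) (e : edge G) : seq (R * R) :=
  zip (0 :: cuts f e) (rcons (cuts f e) 1).

(* A loop at q contributes two vectors. *)
Definition star n (f : mapping R G n) (q : vertex G) : seq 'rV[R]_n :=
  [seq tangent_after (emap f e) 0 | e <- enum (edge G) & source e == q] ++
  [seq tangent_before (emap f e) 1 | e <- enum (edge G) & target e == q].

Definition NTC n (f : mapping R G n) : \bar R :=
  (\sum_(q : vertex G) ntc (star f q) +
   \sum_(e : edge G) \sum_(t <- cuts f e)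
     ntc [:: tangent_before (emap f e) t; tangent_after (emap f e) t] +
   \sum_(e : edge G) \sum_(p <- pieces f e)
     total_curvature (emap f e) p.1 p.2)%E.

Definition NTC_inf : \bar R :=
  ereal_inf [set x | exists n (f : mapping R G n), (0 < n)%N /\ x = NTC f].

End net_total_curvature.

(* q+ is [true] and q- is [false]. *)
Definition theta (m : nat) : graph :=
  @Graph bool 'I_m (fun=> true) (fun=> false).

(* Main.v *)
Require Import Defs.
From mathcomp Require Import all_boot all_order all_algebra.
From mathcomp Require Import all_classical all_reals all_analysis.
From mathcomp Require Import measurable_realfun lra ring.

Set Implicit Arguments.
Unset Strict Implicit.
Unset Printing Implicit Defensive.

Import Order.TTheory GRing.Theory Num.Theory.
Import numFieldNormedType.Exports.

Local Open Scope classical_set_scope.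
Local Open Scope ring_scope.

(** The net total curvature of a mapping f is an average over directions. Fix a
direction x and replace every unit vector u by the sign [side x u] of <x, u>.
Along a smooth arc, count twice the sign changes of <x, T>, T the unit tangent;
at a vertex, take the absolute value of the sum of the signs of the tangent
vectors. Then NTC(f) is at least pi/2 times the average of the total count
([NTC_ge_average]).

For the vertices this is an equality, the sphere measure being symmetric
([ntcE]). For the arcs it is the inequality of Crofton's formula: vectors u, v
with a small distance r are separated by the hyperplane orthogonal to x with
probability at most r / (pi - 3 r) ([lune_le]). Sampling T at the points of finer
and finer subdivisions and applying Fatou's lemma bounds the average number of
sign changes by the length of the curve T divided by pi
([integral_side_variation]), and that length is the integral of the curvature.

The probability bound rests on invariance under rotations. If v is obtained
from u by the angle theta and N theta < pi, then the N pairs of consecutive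
vectors among u, v, ..., got by turning on by theta each time, are equally likely
to be separated, while a hyperplane separates consecutive points of a half turn at
most once ([lune_angle]). So the probability is at most 1/N. The invariance itself follows
from translation invariance and Fubini's theorem ([ge0_integral_mulmx]).

It remains to bound the count from below for almost every x, when the graph is
theta_m ([theta_count_ge]). Let sigma be the sign of the height of q- minus the
height of q+, where the height is measured along x, and sigma = 1 if they are equal.
An edge has a point at which it moves with sign sigma: otherwise its height,
multiplied by sigma, would decrease from q+ to q-, and strictly so if x is not
orthogonal to its initial tangent. The way from the initial sign of the edge to
sigma, and then to its final sign, counts for at least the defects of these two signs
from sigma ([edge_count_ge2]). So every edge contributes at least 2, including its
share in the vertex sums, and the count is at least 2m. Hence NTC(f) >= m pi.

Conversely, m copies of a segment in R^1 have no curvature and attain m pi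
([flat_theta_NTC]). *)

(** * Lebesgue measure on R^n is invariant under translations *)

Section translation.
Context (R : realType).
Local Notation rT := (measurableTypeR R).
Local Notation mu := (@lebesgue_measure R).

Lemma ge0_integral_shift1 (f : R -> \bar R) (a : R) :
  measurable_fun setT f -> (forall x, 0 <= f x)%E ->
  (\int[mu]_x f (x + a)%R = \int[mu]_x f x)%E.
Proof.
move=> mf f0; pose phi := fun x : rT => (x + a)%R : rT.
have mphi : measurable_fun setT phi by exact: measurable_funD.
pose nu : {measure set rT -> \bar R} := 
 @measure_function_pushforward__canonical__measure_function_Measure _ _ _ _ _ mu phi mphi.
have E (A : set rT) : measurable A -> mu A = nu A.
  apply: lebesgue_measure_unique.
  move=> _ [[b c] _ <-] /=; rewrite /pushforward.
  rewrite (_ : _ @^-1` _ = `]b - a, c - a]%classic); last first.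
    by apply/seteqP; split => x /=; rewrite /phi !in_itv/= ltrBlDr lerBrDr.
  rewrite !lebesgue_measure_itv/= !lte_fin ltrBlDr subrK; case: ifP => // _.
  by rewrite -!EFinD opprB addrA subrK.
rewrite [RHS](@eq_measure_integral _ _ _ setT nu mu) //; last first.
  by move=> A mA _; exact: E.
by rewrite ge0_integral_pushforward//.
Qed.

Definition tuple_shift n (a : 'I_n -> R) (x : n.-tuple rT) : n.-tuple rT :=
  [tuple (tnth x i + a i : rT) | i < n].

Lemma tnth_tuple_shift n (a : 'I_n -> R) x i :
  tnth (tuple_shift a x) i = tnth x i + a i.
Proof. by rewrite tnth_mktuple. Qed.

Lemma measurable_tuple_shift n (a : 'I_n -> R) :
  measurable_fun setT (tuple_shift a).
Proof.
apply/measurable_fun_tnthP => i /=.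
rewrite (_ : _ \o _ = fun x : n.-tuple rT => (tnth x i + a i : rT)); last first.
  by apply/funext => x /=; rewrite tnth_tuple_shift.
by apply: measurable_funD => //; exact: measurable_tnth.
Qed.

(** The product structure of the measure, as an iterated integral: this is what
an induction on the dimension uses. *)
Lemma ge0_integral_lebesgue_tupleS n (f : n.+1.-tuple rT -> \bar R) :
  measurable_fun setT f -> (forall x, 0 <= f x)%E ->
  (\int[lebesgue_tuple R n.+1]_x f x =
   \int[mu]_x \int[lebesgue_tuple R n]_v f (consp (x, v)))%E.
Proof.
move=> mf f0 /=.
rewrite ge0_integral_pushforward//; last exact: measurable_consp.
rewrite preimage_setT fubini_tonelli1//.
  by apply: measurableT_comp => //; exact: measurable_consp.
by move=> x /=.
Qed.

Lemma measurable_consp_cst n (c : rT) :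
  measurable_fun setT (fun v : n.-tuple rT => consp (c, v)).
Proof.
exact: (@measurable_cons _ _ _ _ (cst c) n idfun (measurable_cst c)
  (@measurable_id _ _ setT)).
Qed.

Lemma ge0_integral_tuple_shift n (a : 'I_n -> R) (f : n.-tuple rT -> \bar R) :
  measurable_fun setT f -> (forall x, 0 <= f x)%E ->
  (\int[lebesgue_tuple R n]_x f (tuple_shift a x) =
   \int[lebesgue_tuple R n]_x f x)%E.
Proof.
elim: n => [|n IH] in a f *; move=> mf f0.
  by apply: eq_integral => x _; congr f; rewrite [RHS]tuple0 [LHS]tuple0.
have mfs := measurableT_comp mf (measurable_tuple_shift a).
have mfc := measurableT_comp mf (@measurable_consp R n).
rewrite (ge0_integral_lebesgue_tupleS mfs (fun x => f0 _)).
rewrite (ge0_integral_lebesgue_tupleS mf f0).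
under eq_integral => x _.
  rewrite (_ : (fun _ => _) = fun v => f (consp
     (x + a ord0, tuple_shift (a \o lift ord0) v))); last first.
    apply/funext => v /=; congr f; apply: eq_from_tnth => i.
    rewrite tnth_tuple_shift; case: (unliftP ord0 i) => [j ->|->].
      by rewrite !tnthS tnth_tuple_shift.
    by rewrite !tnth0.
  rewrite (IH _ (fun v => f (consp (x + a ord0, v)))); [over | | by move=> v /=].
  apply: (measurableT_comp mf).
  exact: measurable_consp_cst.
rewrite (@ge0_integral_shift1 (fun x => \int[lebesgue_tuple R n]_v f (consp (x, v)))%E (a ord0))//.
- exact: (@measurable_fun_fubini_tonelli_F _ _ _ _ _ (lebesgue_tuple R n)
    (f \o @consp R n) mfc (fun x => f0 (consp x))).
- by move=> x; apply: integral_ge0.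
Qed.

End translation.

(** * Euclidean geometry of row vectors, and the volume of the ball *)

Section euclid.
Context (R : realType) (n : nat).
Implicit Types u v w : 'rV[R]_n.

Lemma dotE u v : dot u v = (u *m v^T) 0 0.
Proof. by rewrite mxE; apply: eq_bigr => i _; rewrite mxE. Qed.

Lemma dotC u v : dot u v = dot v u.
Proof. by apply: eq_bigr => i _; rewrite mulrC. Qed.

Lemma dotDl u v w : dot (u + v) w = dot u w + dot v w.
Proof. by rewrite !dotE mulmxDl mxE. Qed.

Lemma dotZl a u w : dot (a *: u) w = a * dot u w.
Proof. by rewrite !dotE -scalemxAl mxE. Qed.

Lemma dotNl u w : dot (- u) w = - dot u w.
Proof. by rewrite -scaleN1r dotZl mulN1r. Qed.

Lemma dotBl u v w : dot (u - v) w = dot u w - dot v w.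
Proof. by rewrite dotDl dotNl. Qed.

Lemma dotDr u v w : dot w (u + v) = dot w u + dot w v.
Proof. by rewrite dotC dotDl !(dotC w). Qed.

Lemma dotZr a u w : dot w (a *: u) = a * dot w u.
Proof. by rewrite dotC dotZl dotC. Qed.

Lemma dotNr u w : dot w (- u) = - dot w u.
Proof. by rewrite dotC dotNl dotC. Qed.

Lemma dotBr u v w : dot w (u - v) = dot w u - dot w v.
Proof. by rewrite dotDr dotNr. Qed.

Lemma dot0l u : dot 0 u = 0.
Proof. by rewrite -(scale0r 0) dotZl mul0r. Qed.

Lemma dot0r u : dot u 0 = 0.
Proof. by rewrite dotC dot0l. Qed.

Lemma dot_ge0 u : 0 <= dot u u.
Proof. by apply: sumr_ge0 => i _; rewrite -expr2 sqr_ge0. Qed.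

Lemma dot_eq0 u : (dot u u == 0) = (u == 0).
Proof.
apply/idP/eqP => [|->]; last by rewrite dot0l.
rewrite psumr_eq0 => [/allP h|i _]; last by rewrite -expr2 sqr_ge0.
apply/rowP => i; rewrite mxE; apply/eqP.
by have := h i (mem_index_enum _); rewrite mulf_eq0 orbb.
Qed.

Lemma dot_gt0 u : u != 0 -> 0 < dot u u.
Proof. by move=> u0; rewrite lt_neqAle dot_ge0 andbT eq_sym dot_eq0. Qed.

Lemma enorm_ge0 u : 0 <= enorm u.
Proof. exact: sqrtr_ge0. Qed.

Lemma enorm_sqr u : enorm u ^+ 2 = dot u u.
Proof. by rewrite sqr_sqrtr// dot_ge0. Qed.

Lemma enorm_eq0 u : (enorm u == 0) = (u == 0).
Proof. by rewrite -dot_eq0 -enorm_sqr sqrf_eq0. Qed.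

Lemma enorm_gt0 u : u != 0 -> 0 < enorm u.
Proof. by move=> u0; rewrite lt_neqAle enorm_ge0 andbT eq_sym enorm_eq0. Qed.

Lemma enormZ a u : enorm (a *: u) = `|a| * enorm u.
Proof.
by rewrite /enorm dotZl dotZr mulrA -expr2 sqrtrM ?sqr_ge0// sqrtr_sqr.
Qed.

Lemma enormN u : enorm (- u) = enorm u.
Proof. by rewrite -scaleN1r enormZ normrN1 mul1r. Qed.

Lemma enorm_unit_vec u : u != 0 -> enorm (unit_vec u) = 1.
Proof.
move=> u0; rewrite enormZ ger0_norm ?invr_ge0 ?enorm_ge0// mulVf//.
by rewrite enorm_eq0.
Qed.

Lemma unit_vecN u : unit_vec (- u) = - unit_vec u.
Proof. by rewrite /unit_vec enormN scalerN. Qed.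

Lemma dot_mulmx (A : 'M[R]_n) u v : A *m A^T = 1%:M ->
  dot (u *m A) (v *m A) = dot u v.
Proof. by move=> A1; rewrite !dotE trmx_mul mulmxA -(mulmxA u) A1 mulmx1. Qed.

Lemma dot_mulmxr (A : 'M[R]_n) u v : dot (u *m A) v = dot u (v *m A^T).
Proof. by rewrite !dotE trmx_mul trmxK mulmxA. Qed.

(** Cauchy-Schwarz, from the square of | |v| u - |u| v |. *)
Lemma dot_le_enorm u v : dot u v <= enorm u * enorm v.
Proof.
have [->|v0] := eqVneq v 0; first by rewrite dot0r mulr_ge0// enorm_ge0.
have [->|u0] := eqVneq u 0; first by rewrite dot0l mulr_ge0// enorm_ge0.
set a := enorm u; set b := enorm v.
have a0 : 0 < a by exact: enorm_gt0.
have b0 : 0 < b by exact: enorm_gt0.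
have := dot_ge0 (b *: u - a *: v).
rewrite !(dotBl, dotBr, dotZl, dotZr) -!enorm_sqr -/a -/b (dotC v u).
rewrite [X in 0 <= X](_ : _ = (a * b) * (2 * (a * b - dot u v))); last by ring.
by rewrite pmulr_rge0 ?mulr_gt0// pmulr_rge0// subr_ge0.
Qed.

End euclid.

Section invariance.
Context (R : realType) (n : nat).
Local Notation rT := (measurableTypeR R).
Local Notation T := (n.-tuple rT).
Local Notation lam := (lebesgue_tuple R n).
Local Notation vec := (@vec_of_tuple R n).
Local Notation B := (@unit_ball R n).

Definition tuple_of_vec (v : 'rV[R]_n) : T := [tuple (v 0 i : rT) | i < n].

Lemma tuple_of_vecK : cancel tuple_of_vec vec.
Proof. by move=> v; apply/rowP => i; rewrite mxE tnth_mktuple. Qed.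

Lemma vec_of_tupleK : cancel vec tuple_of_vec.
Proof. by move=> x; apply: eq_from_tnth => i; rewrite tnth_mktuple mxE. Qed.

Lemma vec_tuple_shift (a : 'rV[R]_n) x : vec (tuple_shift (a 0) x) = vec x + a.
Proof. by apply/rowP => i; rewrite !mxE tnth_tuple_shift. Qed.

Lemma measurable_dot u : measurable_fun setT (fun x : T => dot (vec x) u : R).
Proof.
apply: measurable_sum => i; apply: measurable_funM => //.
under eq_fun do rewrite mxE.
exact: measurable_tnth.
Qed.

Lemma measurable_tuple_of_vec d (X : measurableType d) (f : X -> 'rV[R]_n) :
  (forall i, measurable_fun setT (fun x => f x 0 i : R)) ->
  measurable_fun setT (tuple_of_vec \o f).
Proof.
move=> mf; apply/measurable_fun_tnthP => i /=.
rewrite (_ : _ \o _ = fun x => f x 0 i : R); first exact: mf.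
by apply/funext => x /=; rewrite tnth_mktuple.
Qed.

Lemma measurable_enorm : measurable_fun setT (fun x : T => enorm (vec x) : R).
Proof.
have ms : measurable_fun setT (@Num.sqrt R).
  by apply: continuous_measurable_fun; exact: sqrt_continuous.
suff md : measurable_fun setT (fun x : T => dot (vec x) (vec x) : R).
  exact: measurableT_comp ms md.
apply: measurable_sum => i; apply: measurable_funM => //;
by under eq_fun do rewrite mxE; exact: measurable_tnth.
Qed.

Lemma measurable_unit_ball : measurable B.
Proof.
have := measurable_enorm measurableT (measurable_itv `]-oo, (1 : R)]).
by rewrite setTI; congr measurable; apply/seteqP; split => x /=; rewrite in_itv.
Qed.

End invariance.

Section volume.
Context (R : realType).
Local Notation rT := (measurableTypeR R).
Local Notation mu := (@lebesgue_measure R).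

Definition cube n (r : R) : set (n.-tuple rT) :=
  [set x | forall i, `|tnth x i : R| <= r].

Arguments cube : clear implicits.

Lemma measurable_cube n r : measurable (cube n r).
Proof.
rewrite (_ : cube n r = \big[setI/setT]_(i < n) [set x | `|tnth x i : R| <= r]).
  apply: bigsetI_measurable => i _.
  have := @measurable_tnth _ rT n i measurableT _ (measurable_itv `[- r, r]).
  rewrite setTI; congr measurable; apply/seteqP.
  by split => x /=; rewrite in_itv/= ler_norml.
apply/seteqP; split => x /=.
  by move=> h; rewrite -bigcap_seq => i _; exact: h.
by rewrite -bigcap_seq => h i; apply: h; rewrite /= mem_index_enum.
Qed.

Lemma lebesgue_tuple_cube n (r : R) : 0 <= r ->
  lebesgue_tuple R n (cube n r) = ((r *+ 2) ^+ n)%:E.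
Proof.
move=> r0; elim: n => [|n IH].
  by rewrite expr0 /= /dirac indicE mem_set// => -[].
rewrite /= /lebesgue_step /pushforward.
rewrite (_ : _ @^-1` _ = [set` `[- r, r]] `*` cube n r); last first.
  apply/seteqP; split => -[x v]/= => [h|[hx hv] i].
    split; first by have := h ord0; rewrite tnth0 ler_norml in_itv.
    by move=> i; have := h (lift ord0 i); rewrite tnthS.
  case: (unliftP ord0 i) => [j ->|->]; first by rewrite tnthS; exact: hv.
  by move: hx; rewrite tnth0 in_itv/= ler_norml.
rewrite product_measure1E//; last exact: measurable_cube.
rewrite [X in (_ * X)%E]IH [X in (X * _)%E](lebesgue_measure_itv `[- r, r])/= lte_fin exprS EFinM.
case: ltP => rr; first by rewrite -EFinD opprK mulr2n.
have -> : r = 0 by apply/eqP; rewrite eq_le r0 andbT; lra.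
by rewrite mul0rn !mul0e.
Qed.

(** The ball lies between two cubes, whose volumes are known. *)
Lemma unit_ball_fin n : (lebesgue_tuple R n (@unit_ball R n) < +oo)%E.
Proof.
apply: (@le_lt_trans _ _ (lebesgue_tuple R n (cube n 1))).
  apply: le_measure; rewrite ?inE; [exact: measurable_unit_ball|
    exact: measurable_cube|].
  move=> x /= h i; rewrite -(ler_pXn2r (n := 2))// ?nnegrE// expr1n real_normK//.
    have : dot (vec_of_tuple x) (vec_of_tuple x) <= 1.
      by rewrite -enorm_sqr -(expr1n _ 2) ler_pXn2r// ?nnegrE ?enorm_ge0.
    apply: le_trans; rewrite /dot (bigD1 i)//= !mxE expr2 lerDl.
    by apply: sumr_ge0 => j _; rewrite -expr2 sqr_ge0.
  exact: num_real.
by rewrite lebesgue_tuple_cube// ltry.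
Qed.

Lemma unit_ball_fin_num n : lebesgue_tuple R n (@unit_ball R n) \is a fin_num.
Proof.
by rewrite ge0_fin_numE; [exact: unit_ball_fin|exact: measure_ge0].
Qed.

Lemma unit_ball_gt0 n : (0 < lebesgue_tuple R n (@unit_ball R n))%E.
Proof.
apply: (@lt_le_trans _ _ (lebesgue_tuple R n (cube n (n.+1%:R^-1)))).
  by rewrite lebesgue_tuple_cube// lte_fin exprn_gt0// mulrn_wgt0// invr_gt0.
apply: le_measure; rewrite ?inE; [exact: measurable_cube|
  exact: measurable_unit_ball|].
move=> x /= h; rewrite /unit_ball/= -sqrtr1 ler_sqrt//.
apply: (@le_trans _ _ (\sum_(i < n) n.+1%:R^-1)).
  apply: ler_sum => i _; rewrite mxE -expr2.
  rewrite -real_normK ?num_real//.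
  apply: (@le_trans _ _ (n.+1%:R^-1 ^+ 2)).
    by rewrite ler_pXn2r ?nnegrE//; exact: h.
  by rewrite expr2 ger_pMr ?invr_gt0// invf_le1 ?ler1n.
rewrite sumr_const card_ord -[leLHS]mulr_natl ler_pdivrMr// mul1r ler_nat.
exact: leqnSn.
Qed.

End volume.

(** * Invariance under orthogonal matrices; hyperplanes are null sets *)

Lemma mule_fin_inj (R : realType) (a : R) (x y : \bar R) :
  0 < a -> (a%:E * x = a%:E * y)%E -> x = y.
Proof.
move=> a0 /eqP; rewrite eq_le !lee_pmul2l// => /andP[le1 le2].
by apply/le_anti/andP.
Qed.

Section invariance.
Context (R : realType) (n : nat).
Local Notation rT := (measurableTypeR R).
Local Notation T := (n.-tuple rT).
Local Notation lam := (lebesgue_tuple R n).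
Local Notation vec := (@vec_of_tuple R n).
Local Notation B := (@unit_ball R n).
Implicit Type A : 'M[R]_n.

Definition tuple_mulmx A (x : T) : T := tuple_of_vec (vec x *m A).

Lemma vec_tuple_mulmx A x : vec (tuple_mulmx A x) = vec x *m A.
Proof. by rewrite tuple_of_vecK. Qed.

Lemma measurable_vec i : measurable_fun setT (fun x : T => vec x 0 i : R).
Proof. by under eq_fun do rewrite mxE; exact: measurable_tnth. Qed.

Lemma measurable_tuple_mulmx A : measurable_fun setT (tuple_mulmx A).
Proof.
apply: measurable_tuple_of_vec => i.
under eq_fun do rewrite mxE.
apply: measurable_sum => j; apply: measurable_funM => //.
exact: measurable_vec.
Qed.

(** Joint measurability of y + s (x A) in x and y, where s = 1 and s = -1 are the
two integrands of the Fubini argument below. *)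
Lemma measurable_shift_mulmx A (s : R) : measurable_fun setT
  (fun z : T * T => tuple_shift ((s *: (vec z.1 *m A)) 0) z.2).
Proof.
rewrite (_ : (fun z => _) = @tuple_of_vec R n \o (fun z : T * T =>
   vec z.2 + s *: vec (tuple_mulmx A z.1))); last first.
  apply/funext => z /=; rewrite -[LHS]vec_of_tupleK vec_tuple_shift.
  by rewrite vec_tuple_mulmx.
apply: measurable_tuple_of_vec => i.
rewrite (_ : (fun z => _) = fun z : T * T =>
   vec z.2 0 i + s * vec (tuple_mulmx A z.1) 0 i); last first.
  by apply/funext => z; rewrite !mxE.
apply: measurable_funD.
  exact: (measurableT_comp (measurable_vec i) measurable_snd).
apply: measurable_funM => //.
apply: (measurableT_comp (measurable_vec i)).
exact: (measurableT_comp (measurable_tuple_mulmx A) measurable_fst).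
Qed.

Lemma indic_unit_ball_mulmx A x : A *m A^T = 1%:M ->
  \1_B (tuple_mulmx A x) = \1_B x :> R.
Proof.
move=> A1; rewrite !indicE; congr (_ %:R); congr nat_of_bool.
by apply/idP/idP; rewrite !inE /unit_ball/= vec_tuple_mulmx /enorm dot_mulmx.
Qed.

(** Let f be the indicator of the unit ball, which A preserves, and write (int f)(int g)
as the integral of f(x) g(y + x A) over x and y. Exchanging the integrations and
translating x by - y A^T turns it into the integral of f(y - x A) g(x A), that is
into (int f)(int g(x A)). As int f is finite and positive, it cancels. This is the
usual proof that an invariant measure is unique up to a factor. *)
Lemma ge0_integral_mulmx A (g : T -> \bar R) :
  A *m A^T = 1%:M ->
  measurable_fun setT g -> (forall x, 0 <= g x)%E ->
  (\int[lam]_x g (tuple_mulmx A x) = \int[lam]_x g x)%E.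
Proof.
move=> A1 mg g0.
have A1' : A^T *m A = 1%:M by exact: mulmx1C.
pose f (x : T) : \bar R := (\1_B x)%:E.
have mf : measurable_fun setT f.
  by apply/measurable_EFinP; apply: measurable_indic; exact: measurable_unit_ball.
have f0 x : (0 <= f x)%E by rewrite lee_fin indicE.
have fA x : f (tuple_mulmx A x) = f x by rewrite /f indic_unit_ball_mulmx.
have fN x y : vec x = - vec y -> f x = f y.
  move=> xy; rewrite /f !indicE; congr (_ %:R%:E); congr nat_of_bool.
  by apply/idP/idP; rewrite !inE /unit_ball/= xy enormN.
have fint : (\int[lam]_x f x = lam B)%E.
  by rewrite integral_indic ?setIT//; exact: measurable_unit_ball.
clearbody f.
pose sh (s : R) (z : T * T) : T := tuple_shift ((s *: (vec z.1 *m A)) 0) z.2.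
have msh s : measurable_fun setT (sh s) by exact: measurable_shift_mulmx.
have mgA := measurableT_comp mg (measurable_tuple_mulmx A).
pose F1 (z : T * T) : \bar R := (f z.1 * g (sh 1%R z))%E.
pose F2 (z : T * T) : \bar R := (f (sh (-1)%R z) * g (tuple_mulmx A z.1))%E.
have E1 : (\int[lam]_x \int[lam]_y F1 (x, y) =
           \int[lam]_x f x * \int[lam]_x g x)%E.
  rewrite -ge0_integralZr//; last exact: integral_ge0.
  apply: eq_integral => x _; rewrite /F1/= ge0_integralZl//; last first.
    exact: (measurableT_comp mg (@measurable_tuple_shift R n ((1 *: (vec x *m A)) 0))).
  by congr (_ * _)%E; rewrite /sh/= ge0_integral_tuple_shift.
have E2 : (\int[lam]_x \int[lam]_y F2 (x, y) =
           \int[lam]_x f x * \int[lam]_x g (tuple_mulmx A x))%E.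
  rewrite -ge0_integralZl//; last by apply: integral_ge0.
  apply: eq_integral => x _; rewrite /F2/= ge0_integralZr//; last first.
    exact: (measurableT_comp mf (@measurable_tuple_shift R n ((-1 *: (vec x *m A)) 0))).
  by congr (_ * _)%E; rewrite /sh/= ge0_integral_tuple_shift.
have mF1 : measurable_fun setT F1.
  apply: emeasurable_funM; first exact: measurableT_comp mf measurable_fst.
  exact: measurableT_comp mg (msh _).
have mF2 : measurable_fun setT F2.
  apply: emeasurable_funM; first exact: measurableT_comp mf (msh _).
  exact: measurableT_comp mgA measurable_fst.
have F10 z : (0 <= F1 z)%E by rewrite mule_ge0.
have F20 z : (0 <= F2 z)%E by rewrite mule_ge0.
have sF y x : F1 (tuple_shift ((- (vec y *m A^T)) 0) x, y) = F2 (x, y).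
  rewrite /F1 /F2 /sh/= scale1r scaleN1r; congr (_ * g _)%E.
    rewrite -fA; apply: fN; rewrite vec_tuple_mulmx !vec_tuple_shift.
    by rewrite mulmxDl mulNmx -mulmxA A1' mulmx1 opprD opprK addrC.
  rewrite -[LHS]vec_of_tupleK vec_tuple_shift; congr tuple_of_vec.
  rewrite vec_tuple_shift mulmxDl mulNmx -mulmxA A1' mulmx1.
  by rewrite addrC subrK.
have E3 : (\int[lam]_x \int[lam]_y F1 (x, y) = \int[lam]_x \int[lam]_y F2 (x, y))%E.
  transitivity (\int[lam]_y \int[lam]_x F1 (x, y))%E.
    exact: (fubini_tonelli F1 mF1 F10).
  transitivity (\int[lam]_y \int[lam]_x F2 (x, y))%E; last first.
    exact/esym/(fubini_tonelli F2 mF2 F20).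
  apply: eq_integral => y _.
  have mFy : measurable_fun setT (fun x : T => F1 (x, y)).
    exact: (measurableT_comp mF1 (pair2_measurable y)).
  rewrite -(ge0_integral_tuple_shift ((- (vec y *m A^T)) 0) mFy (fun x => F10 (x, y))).
  by apply: eq_integral => x _; exact: sF.
have := etrans (esym E1) (etrans E3 E2).
rewrite fint; have [V VE] : exists V : R, lam B = V%:E.
  by exists (fine (lam B)); rewrite fineK; last exact: unit_ball_fin_num.
have V0 : 0 < V by rewrite -lte_fin -VE; exact: unit_ball_gt0.
rewrite VE => h; exact: (esym (mule_fin_inj V0 h)).
Qed.

Lemma ge0_integral_unit_ball_mulmx A (g : T -> \bar R) :
  A *m A^T = 1%:M ->
  measurable_fun setT g -> (forall x, 0 <= g x)%E ->
  (\int[lam]_(x in B) g (tuple_mulmx A x) = \int[lam]_(x in B) g x)%E.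
Proof.
move=> A1 mg g0; rewrite integral_mkcond [RHS]integral_mkcond.
have mB : measurable B by exact: measurable_unit_ball.
have mgB : measurable_fun setT (g \_ B).
  exact: (measurable_restrictT g mB).1 (measurable_funTS mg).
have gB0 x : (0 <= (g \_ B) x)%E by apply: erestrict_ge0 => y _.
rewrite -(ge0_integral_mulmx A1 mgB gB0).
apply: eq_integral => x _; rewrite !patchE.
have /eqP := indic_unit_ball_mulmx x A1; rewrite !indicE.
by rewrite eqr_nat; case: (x \in B); case: (_ \in B).
Qed.

Lemma measurable_hyperplane (v : 'rV[R]_n) :
  measurable [set x : T | dot (vec x) v = 0].
Proof.
have := measurable_dot v measurableT (measurable_set1 (0 : R)).
by rewrite setTI.
Qed.

(** A line in the direction of the normal v meets the hyperplane H once. Integrate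
the indicator of H at x + t v over x and over t in [0, 1]: one order of integration
gives 0, the other gives the measure of H. *)
Lemma hyperplane_null (v : 'rV[R]_n) : v != 0 ->
  lam [set x : T | dot (vec x) v = 0] = 0%E.
Proof.
move=> v0; set H := [set x | _].
have mH : measurable H by exact: measurable_hyperplane.
have vv : dot v v != 0 by rewrite dot_eq0.
pose I := `[0, 1]%classic : set rT.
have mI : measurable I by exact: measurable_itv.
pose F (z : T * rT) : \bar R :=
  (\1_H (tuple_shift ((z.2 *: v) 0) z.1) * \1_I z.2)%:E.
have mF : measurable_fun setT F.
  apply/measurable_EFinP; apply: measurable_funM; last first.
    exact: (measurableT_comp (measurable_indic mI) measurable_snd).
  apply: (measurableT_comp (measurable_indic mH)).
  rewrite (_ : (fun z => _) = @tuple_of_vec R n \o (fun z : T * rT =>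
      vec z.1 + z.2 *: v)); last first.
    by apply/funext => z /=; rewrite -[LHS]vec_of_tupleK vec_tuple_shift.
  apply: measurable_tuple_of_vec => i.
  rewrite (_ : (fun z => _) = fun z : T * rT =>
    vec z.1 0 i + z.2 * v 0 i); last by apply/funext => z; rewrite !mxE.
  apply: measurable_funD.
    exact: (measurableT_comp (measurable_vec i) measurable_fst).
  by apply: measurable_funM.
have F0 z : (0 <= F z)%E by rewrite lee_fin mulr_ge0 ?indicE.
transitivity (\int[lam]_x \int[@lebesgue_measure R]_t F (x, t))%E; last first.
  apply: integral0_eq => x _; apply/eqP.
  rewrite eq_le integral_ge0 ?andbT; last by move=> t _; exact: F0.
  pose t0 : rT := - dot (vec x) v / dot v v.
  have mt0 : measurable [set t0] by exact: measurable_set1.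
  have := @integral_indic _ _ _ (@lebesgue_measure R) setT measurableT _ mt0.
  rewrite setIT [X in _ = X]lebesgue_measure_set1 => <-.
  apply: ge0_le_integral => //.
  - exact: (measurableT_comp mF (pair1_measurable x)).
  - by apply/measurable_EFinP; exact: measurable_indic.
  - move=> t _; rewrite lee_fin /F/= !indicE.
    have [|] := boolP (_ \in H); last by rewrite mul0r.
    rewrite inE /H/= vec_tuple_shift dotDl dotZl => h.
    have -> : t = t0.
      by apply: (mulIf vv); rewrite divfK// -[RHS]addr0 -h addrA addNr add0r.
    rewrite mul1r [t0 \in [set t0]]mem_set//.
    by case: (_ \in _) => /=; rewrite ?ler01.
rewrite (fubini_tonelli (m1 := lam) (m2 := @lebesgue_measure R) F mF F0).
transitivity (\int[@lebesgue_measure R]_t (lam H * (\1_I t)%:E))%E.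
  have mI' : measurable_fun setT (fun t : rT => (\1_I t)%:E : \bar R).
    by apply/measurable_EFinP; exact: measurable_indic.
  rewrite (ge0_integralZl _ measurableT mI'); last 2 first.
  - by move=> t _; rewrite lee_fin indicE.
  - exact: measure_ge0.
  rewrite integral_indic// setIT [X in (_ * X)%E](lebesgue_measure_itv `[0, 1]).
  by rewrite /= lte_fin ltr01 oppr0 adde0 mule1.
apply: eq_integral => t _; rewrite /F/=.
under eq_integral do rewrite EFinM.
have mHf : measurable_fun setT (fun x : T => (\1_H x)%:E : \bar R).
  by apply/measurable_EFinP; exact: measurable_indic.
have mHs := measurableT_comp mHf (@measurable_tuple_shift R n ((t *: v) 0)).
rewrite ge0_integralZr//; congr (_ * _)%E.
rewrite (ge0_integral_tuple_shift ((t *: v) 0) mHf)//.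
by rewrite integral_indic// setIT.
Qed.

End invariance.

(** * Signs along a half turn *)

Section sign_changes.
Context (R : realType).

Lemma le_sgr (x y : R) : x <= y -> Num.sg x <= Num.sg y.
Proof.
by case: (sgrP x); case: (sgrP y) => //; lra.
Qed.

Lemma sgr_bound (x : R) : -1 <= Num.sg x <= 1.
Proof. by case: sgrP => _; lra. Qed.

Lemma telescope_nonincreasing (f : nat -> R) N :
  (forall k, (k < N)%N -> f k.+1 <= f k) ->
  \sum_(k < N) `|f k - f k.+1| = f 0 - f N.
Proof.
elim: N => [|N IH] h; first by rewrite big_ord0 subrr.
rewrite big_ord_recr/= IH => [|k kN]; last exact/h/ltnW.
by rewrite ger0_norm ?subr_ge0 ?h// addrA subrK.
Qed.

(** On [0, pi[ the sign of h = a cos + b sin is monotone, so that the sum telescopes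
to at most 1 - (-1). For successive angles p and q = p + theta, the monotonicity is
read off the identity h(p) sin q - h(q) sin p = a sin theta, both sines being
positive. *)
Lemma sign_changes_half_turn (a b theta : R) N :
  0 < theta -> N%:R * theta < pi ->
  let f k := Num.sg (a * cos (k%:R * theta) + b * sin (k%:R * theta)) in
  \sum_(k < N) `|f k - f k.+1| <= 2.
Proof.
move=> t0 Nt.
(* Up to the symmetry (a, b) -> (-a, -b), the sign is nonincreasing. *)
pose S a b := \sum_(k < N)
  `|Num.sg (a * cos (k%:R * theta) + b * sin (k%:R * theta)) -
    Num.sg (a * cos (k.+1%:R * theta) + b * sin (k.+1%:R * theta))|.
rewrite /= -[X in X <= 2]/(S a b).
have SN : S (- a) (- b) = S a b.
  by apply: eq_bigr => k _; rewrite !mulNr -!opprD !sgrN -opprD normrN.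
suff {a b SN} wl a b : 0 < a \/ (a = 0 /\ b <= 0) -> S a b <= 2.
  have [a0|a0|a0] := ltgtP 0 a.
  - by apply: wl; left.
  - by rewrite -SN; apply: wl; left; rewrite oppr_gt0.
  have [b0|b0] := leP b 0; first by apply: wl; right.
  by rewrite -SN; apply: wl; right; rewrite -a0 oppr0 oppr_le0 ltW.
move=> ab; pose f k := Num.sg (a * cos (k%:R * theta) + b * sin (k%:R * theta)).
have s_gt0 k : (k < N)%N -> 0 < sin (k.+1%:R * theta).
  move=> kN; apply: sin_gt0_pi; rewrite mulr_gt0//=.
  by apply: le_lt_trans Nt; rewrite ler_pM2r// ler_nat.
have thpi : (0 < N)%N -> 0 < sin theta.
  by move=> N0; have := s_gt0 0%N N0; rewrite mul1r.
rewrite /S (telescope_nonincreasing (f := f)).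
  have /andP[_ +] := sgr_bound (a * cos (0%:R * theta) + b * sin (0%:R * theta)).
  have /andP[+ _] := sgr_bound (a * cos (N%:R * theta) + b * sin (N%:R * theta)).
  rewrite /f; lra.
case=> [|k] kN.
  rewrite /f mul0r cos0 sin0 mulr0 addr0 mulr1 mul1r.
  case: ab => [a0|[-> b0]].
    by rewrite [leRHS]gtr0_sg//; have /andP[] := sgr_bound (a * cos theta + b * sin theta).
  by rewrite mul0r add0r sgr0 sgr_le0 mulr_le0_ge0// ltW// thpi.
have a_ge0 : 0 <= a by case: ab => [/ltW//|[->]].
set p := k.+1%:R * theta.
have qE : k.+2%:R * theta = p + theta by rewrite /p -[k.+2]addn1 natrD mulrDl mul1r.
have sp : 0 < sin p by apply: s_gt0; exact: ltnW.
have sq : 0 < sin (p + theta) by rewrite -qE; exact: s_gt0.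
rewrite /f -/p qE.
rewrite -[leLHS]mulr1 -{1}(gtr0_sg sp) -sgrM -[leRHS]mulr1 -{1}(gtr0_sg sq) -sgrM.
apply: le_sgr; rewrite -subr_ge0.
have st : 0 <= sin theta by apply/ltW/thpi; case: (N) kN.
rewrite [leRHS](_ : _ = a * sin theta * (cos p ^+ 2 + sin p ^+ 2)).
  by rewrite cos2Dsin2 mulr1 mulr_ge0.
by rewrite cosD sinD; ring.
Qed.

(** The mean value theorem for sin on [0, psi], cos being decreasing. *)
Lemma mul_cos_le_sin (psi : R) : 0 <= psi <= pi / 2 ->
  psi * cos psi <= sin psi.
Proof.
move=> /andP[p0 ppi]; move: p0; rewrite le_eqVlt => /orP[/eqP<-|p0].
  by rewrite mul0r sin0.
have [c] := @MVT R sin cos 0 psi p0 (fun x _ => is_derive_sin x)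
  (continuous_subspaceT (@continuous_sin R)).
rewrite in_itv/= sin0 !subr0 => /andP[c0 cp] ->; rewrite mulrC ler_pM2r//.
have pi2 : pi / 2 < pi :> R by have := pi_gt0 R; lra.
apply/ltW; rewrite ltr_cos// in_itv/=; apply/andP; split; lra.
Qed.

End sign_changes.

(** * The probability that a random hyperplane separates two vectors *)

Section directions.
Context (R : realType) (n : nat).
Local Notation rT := (measurableTypeR R).
Local Notation T := (n.-tuple rT).
Local Notation lam := (lebesgue_tuple R n).
Local Notation vec := (@vec_of_tuple R n).
Local Notation B := (@unit_ball R n).

(** Which side of the hyperplane orthogonal to x the vector u lies on. The point x
ranges over the ball instead of the sphere: the sign is the same for x / |x|. *)
Definition side (x : T) (u : 'rV[R]_n) : R := Num.sg (dot (vec x) u).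

Definition ball_volume : R := fine (lam B).
Local Notation V := ball_volume.

Lemma ball_volumeE : lam B = V%:E.
Proof. by rewrite /V fineK//; exact: unit_ball_fin_num. Qed.

Lemma ball_volume_gt0 : 0 < V.
Proof. by rewrite -lte_fin -ball_volumeE; exact: unit_ball_gt0. Qed.

Lemma measurable_sgr : measurable_fun setT (@Num.sg R).
Proof. by apply: nondecreasing_measurable => // x y /le_sgr. Qed.

Lemma measurable_side u : measurable_fun setT (fun x : T => side x u : R).
Proof. exact: (measurableT_comp measurable_sgr (measurable_dot u)). Qed.

Lemma sideN x u : side x (- u) = - side x u.
Proof. by rewrite /side dotNr sgrN. Qed.

Lemma side_mulmx (A : 'M[R]_n) x u :
  side (tuple_mulmx A x) u = side x (u *m A^T).
Proof. by rewrite /side vec_tuple_mulmx dot_mulmxr. Qed.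

Lemma chi_unit_vec u x : chi u (unit_vec (vec x)) = - side x u.
Proof.
rewrite /chi /unit_vec /side dotZl; congr (- _).
have [->|x0] := eqVneq (vec x) 0; first by rewrite dot0l mulr0.
by rewrite sgrM gtr0_sg ?mul1r// invr_gt0 enorm_gt0.
Qed.

(** By the symmetry x -> -x, the positive part of a sum of signs has the same
average as its negative part, so each has half the average of the absolute
value. *)
Lemma ntcE (Ts : seq 'rV[R]_n) :
  ntc Ts = ((pi / 2 / V)%:E *
    \int[lam]_(x in B) (`|\sum_(u <- Ts) side x u|)%:E)%E.
Proof.
pose S x := \sum_(u <- Ts) side x u.
have mB : measurable B by exact: measurable_unit_ball.
have mS : measurable_fun setT S.
  exact: (@measurable_sum _ _ _ setT _ Ts (fun u x => side x u) measurable_side).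
pose P x := Num.max (S x) 0; pose Q x := Num.max (- S x) 0.
have mP : measurable_fun setT P.
  exact: (measurable_maxr mS (@measurable_cst _ _ T R setT (0 : R))).
have mQ : measurable_fun setT Q.
  exact: (measurable_maxr (measurable_funN mS) (@measurable_cst _ _ T R setT (0 : R))).
have P0 x : (0 <= (P x)%:E)%E by rewrite lee_fin le_max lexx orbT.
have Q0 x : (0 <= (Q x)%:E)%E by rewrite lee_fin le_max lexx orbT.
have EPQ : (\int[lam]_(x in B) (P x)%:E = \int[lam]_(x in B) (Q x)%:E)%E.
  have N1 : (- 1%:M : 'M[R]_n) *m (- 1%:M)^T = 1%:M.
    by rewrite linearN/= trmx1 mulNmx mulmxN opprK mulmx1.
  have mP' : measurable_fun setT (fun x => (P x)%:E : \bar R) by exact/measurable_EFinP.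
  rewrite -(ge0_integral_unit_ball_mulmx N1 mP' P0).
  apply: eq_integral => x _; congr (Num.max _ 0)%:E.
  rewrite /S -sumrN; apply: eq_bigr => u _.
  by rewrite side_mulmx linearN/= trmx1 mulmxN mulmx1 sideN.
have EA : (\int[lam]_(x in B) (`|S x|)%:E =
           \int[lam]_(x in B) (Q x)%:E + \int[lam]_(x in B) (Q x)%:E)%E.
  rewrite -{1}EPQ -ge0_integralD//; first last.
  - by apply/measurable_EFinP; exact: measurable_funTS.
  - by apply/measurable_EFinP; exact: measurable_funTS.
  apply: eq_integral => x _; rewrite -EFinD; congr EFin; rewrite /P /Q.
  have [s0|s0] := leP 0 (S x).
    by rewrite max_r ?oppr_le0// addr0 ger0_norm.
  by rewrite max_l ?oppr_ge0 ?ltW// add0r ltr0_norm.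
rewrite /ntc /sphere_average -/V EA.
set q := (\int[lam]_(x in B) (Q x)%:E)%E.
have -> : (\int[lam]_(x in B) (Num.max (\sum_(u <- Ts) chi u (unit_vec (vec x))) 0)%:E = q)%E.
  apply: eq_integral => x _; congr (Num.max _ 0)%:E.
  by rewrite /S -sumrN; apply: eq_bigr => u _; rewrite chi_unit_vec.
have -> : (q + q = 2%:E * q)%E.
  by rewrite -[2]/(1 + 1)%R EFinD ge0_muleDl ?lee_fin// mul1e.
rewrite !muleA -!EFinM; congr (_%:E * _)%E.
by field; rewrite lt0r_neq0// ball_volume_gt0.
Qed.

(** Up to a null set, twice the volume of the set of x whose hyperplane separates u
from v, a double lune of the ball. *)
Definition lune u v : \bar R :=
  (\int[lam]_(x in B) (`|side x u - side x v|)%:E)%E.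

Lemma measurable_side_diff u v : measurable_fun setT
  (fun x : T => (`|side x u - side x v|)%:E : \bar R).
Proof.
apply/measurable_EFinP; apply: measurableT_comp => //.
by apply: measurable_funB; exact: measurable_side.
Qed.

Lemma lune_mulmx (A : 'M[R]_n) u v : A *m A^T = 1%:M ->
  lune (u *m A) (v *m A) = lune u v.
Proof.
move=> A1; have A2 : A^T *m A^T^T = 1%:M by rewrite trmxK; exact: mulmx1C.
rewrite /lune.
rewrite -(ge0_integral_unit_ball_mulmx A2 (measurable_side_diff u v)).
  by apply: eq_integral => x _; rewrite !side_mulmx trmxK.
by move=> x; rewrite lee_fin.
Qed.

(** The half turn about v, that is the orthogonal matrix 2 v^T v - 1, fixes v and maps u
to 2 <u, v> v - u. When u and v are consecutive points of
an equally spaced sequence on a great circle, the image of u is the next one. *)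
Lemma lune_reflect (u v : 'rV[R]_n) : enorm v = 1 ->
  lune u v = lune v ((2 * dot u v) *: v - u).
Proof.
move=> v1; have vv : v *m v^T = 1%:M.
  by apply/matrixP => i j; rewrite !ord1 -dotE -enorm_sqr v1 expr1n mxE eqxx.
pose A := 2 *: (v^T *m v) - 1%:M.
have AT : A^T = A.
  by rewrite /A linearB/= linearZ/= trmx1 trmx_mul trmxK.
have A1 : A *m A^T = 1%:M.
  rewrite AT /A mulmxBl mulmxBr !mul1mx mulmx1 -scalemxAl -scalemxAr.
  rewrite -mulmxA (mulmxA v) vv mul1mx.
  by move: (v^T *m v) => M; apply/matrixP => i j; rewrite !mxE; ring.
have vA : v *m A = v.
  by rewrite /A mulmxBr mulmx1 -scalemxAr mulmxA vv mul1mx scaler_nat mulr2n addrK.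
have uA : u *m A = (2 * dot u v) *: v - u.
  rewrite /A mulmxBr mulmx1 -scalemxAr mulmxA [u *m v^T]mx11_scalar -dotE.
  by rewrite mul_scalar_mx scalerA.
rewrite -(lune_mulmx u v A1) vA uA; apply: eq_integral => x _.
by rewrite distrC.
Qed.

Lemma half_turn_steps (theta : R) : 0 < theta ->
  exists N, N%:R * theta < pi <= N.+1%:R * theta.
Proof.
move=> t0.
have ex : exists k, pi <= k%:R * theta.
  exists (Num.bound (pi / theta)).
  by rewrite -ler_pdivrMr// ltW// archi_boundP// divr_ge0 ?pi_ge0// ltW.
case: (ex_minnP ex) => -[|N]; first by rewrite mul0r leNgt pi_gt0.
move=> h hmin; exists N; rewrite h andbT ltNge; apply/negP => /hmin.
by rewrite ltnn.
Qed.

(** The points at angles 0, theta, ..., N theta of a great circle form N equal lunes,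
and a hyperplane separates consecutive points at most once along a half turn. *)
Lemma lune_angle (u w : 'rV[R]_n) (theta : R) N :
  dot u u = 1 -> dot w w = 1 -> dot u w = 0 ->
  0 < theta -> N%:R * theta < pi ->
  (N%:R%:E * lune u (cos theta *: u + sin theta *: w) <= (2 * V)%:E)%E.
Proof.
move=> uu ww uw t0 Nt.
pose p k := cos (k%:R * theta) *: u + sin (k%:R * theta) *: w.
have dp k l : dot (p k) (p l) = cos (k%:R * theta) * cos (l%:R * theta)
    + sin (k%:R * theta) * sin (l%:R * theta).
  rewrite !(dotDl, dotDr, dotZl, dotZr) uu ww uw (dotC w u) uw; ring.
have p1 k : enorm (p k) = 1.
  by rewrite /enorm dp -!expr2 cos2Dsin2 sqrtr1.
have pS k : p k.+2 = (2 * dot (p k) (p k.+1)) *: p k.+1 - p k.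
  rewrite dp /p; set t := k%:R * theta.
  have -> : k.+1%:R * theta = t + theta by rewrite -[k.+1]addn1 natrD mulrDl mul1r.
  have -> : k.+2%:R * theta = t + theta + theta.
    by rewrite -[k.+2]addn2 natrD mulrDl -addrA; congr (_ + _); ring.
  have h : cos t * cos (t + theta) + sin t * sin (t + theta) = cos theta.
    rewrite cosD sinD; transitivity (cos theta * (cos t ^+ 2 + sin t ^+ 2)).
      by ring.
    by rewrite cos2Dsin2 mulr1.
  have c2 := cos2Dsin2 theta.
  rewrite h; apply/rowP => i; rewrite !mxE.
  rewrite (cosD (t + theta)) (sinD (t + theta)) (cosD t) (sinD t).
  apply/eqP; rewrite -subr_eq0; apply/eqP.
  rewrite [LHS](_ : _ = (cos t * u 0 i + sin t * w 0 i) *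
    (1 - (cos theta ^+ 2 + sin theta ^+ 2))); last by ring.
  by rewrite c2 subrr mulr0.
have lune_p k : lune (p k) (p k.+1) = lune (p 0%N) (p 1%N).
  elim: k => [//|k <-]; rewrite pS.
  exact/esym/lune_reflect.
have p01 : lune (p 0%N) (p 1%N) = lune u (cos theta *: u + sin theta *: w).
  by rewrite /p mul0r mul1r cos0 sin0 scale1r scale0r addr0.
rewrite -p01.
have -> : (N%:R%:E * lune (p 0%N) (p 1%N) = \sum_(k < N) lune (p k) (p k.+1))%E.
  rewrite (eq_bigr (fun=> lune (p 0%N) (p 1%N))); last by move=> k _; exact: lune_p.
  by rewrite sumr_const card_ord mule_natl.
rewrite -[leLHS](@ge0_integral_sum _ _ _ lam B _ 'I_N (fun k x => (`|side x (p k) - side x (p k.+1)|)%:E)); last 3 first.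
- exact: measurable_unit_ball.
- by move=> k; apply: measurable_funTS; exact: measurable_side_diff.
- by move=> k x _; rewrite lee_fin.
apply: (@le_trans _ _ (\int[lam]_(x in B) (cst 2%:E) x)%E).
  apply: ge0_le_integral.
  - exact: measurable_unit_ball.
  - by move=> x _; apply: sume_ge0 => k _; rewrite lee_fin.
  - apply: emeasurable_sum => k; apply: measurable_funTS.
    exact: measurable_side_diff.
  - exact: measurable_cst.
  - move=> x _; rewrite sumEFin lee_fin.
    rewrite (eq_bigr (fun k : 'I_N =>
      `|Num.sg (dot (vec x) u * cos (k%:R * theta) + dot (vec x) w * sin (k%:R * theta))
      - Num.sg (dot (vec x) u * cos (k.+1%:R * theta) + dot (vec x) w * sin (k.+1%:R * theta))|)).
      exact: (sign_changes_half_turn _ _ t0 Nt).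
    by move=> k _; rewrite /side /p !(dotDr, dotZr) ![_ * dot _ _]mulrC.
rewrite integral_cst; last exact: measurable_unit_ball.
by rewrite [X in (_ * X)%E]ball_volumeE.
Qed.

(** The exact probability is theta / pi, theta the angle between u and v; to first
order in r the two agree, and this is all that fine subdivisions need. Take N maximal
with N theta < pi, so that pi <= (N + 1) theta, and theta (1 - r / 2) <= r by
[mul_cos_le_sin], because sin (theta / 2) = r / 2 and cos (theta / 2) >= 1 - r / 2.
With pi <= 4 this gives N >= (pi - 3 r) / r. *)
Lemma lune_le (u v : 'rV[R]_n) : enorm u = 1 -> enorm v = 1 ->
  enorm (u - v) <= 2^-1 ->
  (lune u v <= (2 * V * enorm (u - v) / (pi - 3 * enorm (u - v)))%:E)%E.
Proof.
move=> u1 v1; set r := enorm (u - v) => rle.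
have r_ge0 : 0 <= r by exact: enorm_ge0.
have uu : dot u u = 1 by rewrite -enorm_sqr u1 expr1n.
have vv : dot v v = 1 by rewrite -enorm_sqr v1 expr1n.
have V0 := ball_volume_gt0.
have pi2 := pi_ge2 R.
have uvr : dot u v = 1 - r ^+ 2 / 2.
  by rewrite enorm_sqr !(dotBl, dotBr) uu vv (dotC v u); field.
have den : 0 < pi - 3 * r by lra.
have [r0|r_neq0] := eqVneq r 0.
  have -> : u = v by apply/eqP; rewrite -subr_eq0 -enorm_eq0 -/r r0.
  rewrite /lune integral0_eq.
    by rewrite lee_fin r0 mulr0 mul0r.
  by move=> x _; rewrite subrr normr0.
have r_gt0 : 0 < r by rewrite lt_neqAle eq_sym r_neq0.
pose theta := acos (dot u v).
have r2le : r ^+ 2 <= 2^-1 ^+ 2 by rewrite ler_pXn2r ?nnegrE// invr_ge0.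
have r2gt : 0 < r ^+ 2 by rewrite exprn_gt0.
have cI : -1 <= dot u v <= 1.
  by rewrite uvr; apply/andP; split; move: r2le r2gt; lra.
have cth : cos theta = dot u v by rewrite acosK// in_itv.
have thpi : theta <= pi by exact: acos_lepi.
have th0 : 0 < theta.
  apply: acos_gt0; move: cI => /andP[-> _] /=; rewrite uvr; lra.
have sth : 0 < sin theta.
  apply: sin_gt0_pi; rewrite th0 /=; apply: acos_ltpi.
  by move: cI => /andP[_ ->]; rewrite andbT uvr; move: r2le; lra.
pose w := (sin theta)^-1 *: (v - cos theta *: u).
have vE : v = cos theta *: u + sin theta *: w.
  by rewrite /w scalerA divff ?gt_eqF// scale1r addrC subrK.
have uw : dot u w = 0.
  by rewrite dotZr dotBr dotZr uu cth mulr1 subrr mulr0.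
have ww : dot w w = 1.
  rewrite dotZr dotZl !(dotBl, dotBr, dotZl, dotZr) uu vv (dotC v u) -cth.
  have s2 : 1 - cos theta ^+ 2 = sin theta ^+ 2 by rewrite sin2cos2.
  rewrite [X in _ * (_ * X)](_ : _ = sin theta ^+ 2); last by rewrite -s2; ring.
  by field; rewrite gt_eqF.
have [N /andP[Nth thN]] := half_turn_steps th0.
have h := lune_angle uu ww uw th0 Nth.
rewrite -vE in h.
pose psi := theta / 2.
have thE : theta = psi *+ 2 by rewrite /psi mulr2n; field.
have spsi : sin psi = r / 2.
  have : sin psi ^+ 2 = (r / 2) ^+ 2.
    have : cos theta = 1 - r ^+ 2 / 2 by rewrite cth.
    by rewrite thE cos_mulr2n cos2sin2 expr_div_n; lra.
  move/eqP; rewrite eqrXn2 => [/eqP//|||].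
  - by [].
  - by apply: sin_ge0_pi; rewrite /psi; lra.
  - by lra.
have psi_itv : 0 <= psi <= pi / 2 by rewrite /psi; apply/andP; split; lra.
have hpsi := mul_cos_le_sin psi_itv.
have cpsi : 1 - r / 2 <= cos psi.
  have c2 : cos psi ^+ 2 = 1 - r ^+ 2 / 4 by rewrite cos2sin2 spsi; field.
  rewrite -(ler_pXn2r (n := 2))// ?nnegrE.
  - by rewrite c2 expr2; move: r_gt0 rle; nra.
  - by lra.
  - by apply: cos_ge0_pihalf; move: psi_itv; lra.
have thr : theta * (1 - r / 2) <= r.
  have : psi * (1 - r / 2) <= psi * cos psi.
    by rewrite ler_wpM2l//; case/andP: psi_itv.
  have -> : theta * (1 - r / 2) = 2 * (psi * (1 - r / 2)) by rewrite thE; ring.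
  by move: hpsi; rewrite spsi; lra.
have NV : (pi - 3 * r) / r <= N%:R.
  have pi4 := pihalf_lt2 R.
  rewrite ler_pdivrMr//.
  have thN' : pi <= (N%:R + 1) * theta by rewrite natr1.
  have : pi * (1 - r / 2) <= (N%:R + 1) * r.
    apply: (@le_trans _ _ ((N%:R + 1) * theta * (1 - r / 2))).
      by rewrite ler_wpM2r//; lra.
    by rewrite -mulrA ler_wpM2l// addr_ge0.
  have pir : pi * r <= 4 * r by rewrite ler_wpM2r//; move: pi4; lra.
  by move: pir; lra.
have N0 : 0 < N%:R :> R by apply: lt_le_trans NV; rewrite divr_gt0.
rewrite -(@lee_pmul2l _ N%:R%:E)//; apply: (le_trans h).
rewrite -EFinM lee_fin.
have -> : N%:R * (2 * V * r / (pi - 3 * r)) = 2 * V * (N%:R * r / (pi - 3 * r)) by ring.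
rewrite ler_peMr//; first by lra.
by rewrite ler_pdivlMr// mul1r -ler_pdivrMr.
Qed.

End directions.

(** * Crofton's inequality for curves on the sphere *)

Section limn_einf_bounds.
Context (R : realType).
Implicit Types (u : (\bar R)^nat) (c : \bar R).

Lemma limn_einf_supE u : limn_einf u = ereal_sup (range (einfs u)).
Proof.
rewrite limn_einf_lim; apply/cvg_lim => //.
by apply: ereal_nondecreasing_cvgn; exact: nondecreasing_einfs.
Qed.

Lemma le_limn_einf u c N :
  (forall k, (N <= k)%N -> (c <= u k)%E) -> (c <= limn_einf u)%E.
Proof.
move=> h; rewrite limn_einf_supE.
apply: (@le_trans _ _ (einfs u N)); last by apply: ereal_sup_ubound; exists N.
by apply: le_ereal_inf_tmp => _ [k /= Nk <-]; exact: h.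
Qed.

Lemma limn_einf_le u c :
  (forall N, exists2 k, (N <= k)%N & (u k <= c)%E) -> (limn_einf u <= c)%E.
Proof.
move=> h; rewrite limn_einf_supE; apply: ge_ereal_sup => _ [N _ <-].
have [k Nk uc] := h N; apply: le_trans uc; apply: ereal_inf_lbound.
by exists k.
Qed.

End limn_einf_bounds.

Section sign_variation.
Context (R : realType) (n : nat).
Local Notation rT := (measurableTypeR R).
Local Notation T := (n.-tuple rT).
Local Notation lam := (lebesgue_tuple R n).
Local Notation vec := (@vec_of_tuple R n).
Local Notation B := (@unit_ball R n).
Local Notation V := (ball_volume R n).

(** The subdivision of [a, b] into k+1 equal parts, i running from 0 to k+1. *)
Definition node (a b : R) (k i : nat) : R := a + (b - a) * (i%:R / k.+1%:R).

Lemma node0 a b k : node a b k 0 = a.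
Proof. by rewrite /node mul0r mulr0 addr0. Qed.

Lemma nodeS a b k : node a b k k.+1 = b.
Proof. by rewrite /node divff// mulr1 addrC subrK. Qed.

Lemma node_diff a b k i : node a b k i.+1 - node a b k i = (b - a) / k.+1%:R.
Proof.
rewrite /node -[i.+1]addn1 natrD; set d := (k.+1%:R : R).
have d0 : d != 0 by rewrite /d pnatr_eq0.
by field.
Qed.

Lemma node_itv a b k i : a <= b -> (i <= k.+1)%N -> a <= node a b k i <= b.
Proof.
move=> ab ik; rewrite /node lerDl mulr_ge0 ?subr_ge0 ?divr_ge0//=.
rewrite -lerBrDl -[leRHS]mulr1 ler_wpM2l ?subr_ge0//.
by rewrite ler_pdivrMr// mul1r ler_nat.
Qed.

Definition sampled_variation (tau : R -> 'rV[R]_n) a b k (x : T) : R :=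
  \sum_(i < k.+1) `|side x (tau (node a b k i)) - side x (tau (node a b k i.+1))|.

(** The sign changes of <x, tau>, each counted twice, as seen by finer and finer
subdivisions. The inferior limit is what Fatou's lemma bounds. *)
Definition side_variation (tau : R -> 'rV[R]_n) a b (x : T) : \bar R :=
  limn_einf (fun k => (sampled_variation tau a b k x)%:E).

Lemma measurable_side_variation tau a b :
  measurable_fun setT (side_variation tau a b).
Proof.
apply: measurableT_comp => //; apply: measurable_fun_limn_esup => k.
apply: measurableT_comp => //; apply/measurable_EFinP.
apply: measurable_sum => i; apply/measurable_EFinP.
exact: measurable_side_diff.
Qed.

Lemma side_variation_ge0 tau a b x : (0 <= side_variation tau a b x)%E.
Proof.
apply: (@le_limn_einf _ _ _ 0) => k _; rewrite lee_fin.
by apply: sumr_ge0.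
Qed.

(** The triangle inequality along the nodes before and after the i-th one. *)
Lemma le_sampled_variation tau a b k (i : nat) x : (i <= k.+1)%N ->
  `|side x (tau a) - side x (tau (node a b k i))| +
  `|side x (tau (node a b k i)) - side x (tau b)| <= sampled_variation tau a b k x.
Proof.
pose s j := side x (tau (node a b k j)).
have chain p q : (p <= q)%N -> `|s p - s q| <= \sum_(p <= j < q) `|s j - s j.+1|.
  elim: q => [|q IH]; first by rewrite leqn0 => /eqP->; rewrite subrr normr0 big_geq.
  rewrite leq_eqVlt => /orP[/eqP->|]; first by rewrite subrr normr0 big_geq.
  rewrite ltnS => pq; rewrite big_nat_recr//=.
  rewrite (le_trans (ler_distD (s q) _ _))// lerD2r; exact: IH.
move=> ik; rewrite /sampled_variation.
rewrite -(big_mkord xpredT (fun j => `|s j - s j.+1|)).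
rewrite (big_cat_nat (n := i))//=.
have -> : side x (tau a) = s 0 by rewrite /s node0.
have -> : side x (tau b) = s k.+1 by rewrite /s nodeS.
by rewrite lerD// chain.
Qed.

Lemma side_variation_ends tau a b x :
  ((`|side x (tau a) - side x (tau b)|)%:E <= side_variation tau a b x)%E.
Proof.
apply: (@le_limn_einf _ _ _ 0) => k _; rewrite lee_fin.
have := @le_sampled_variation tau a b k 0 x (leq0n _).
by rewrite node0 subrr normr0 add0r.
Qed.

(** In the application, Phi is the length of the spherical curve tau. *)
Section lipschitz.
Variables (tau : R -> 'rV[R]_n) (Phi : R -> R) (a b C : R).
Hypothesis ab : a < b.
Hypothesis tau1 : forall t, a <= t <= b -> enorm (tau t) = 1.
Hypothesis tauPhi : forall s t, a <= s -> s <= t -> t <= b ->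
  enorm (tau t - tau s) <= Phi t - Phi s.
Hypothesis PhiC : forall s t, a <= s -> s <= t -> t <= b ->
  Phi t - Phi s <= C * (t - s).

Let C_ge0 : 0 <= C.
Proof.
have h := le_trans (tauPhi (lexx a) (ltW ab) (lexx b)) (PhiC (lexx a) (ltW ab) (lexx b)).
rewrite -(pmulr_lge0 (x := b - a)) ?subr_gt0//.
exact: le_trans (enorm_ge0 _) h.
Qed.

(** By continuity the sign at t is also the sign at a node near t, as soon as the
subdivision is fine enough, and the sign must go from its value at a to its value at
t, and then to its value at b. *)
Lemma side_variation_through t x : a <= t <= b -> side x (tau t) != 0 ->
  ((`|side x (tau a) - side x (tau t)| + `|side x (tau t) - side x (tau b)|)%:E
    <= side_variation tau a b x)%E.
Proof.
move=> /andP[at_ tb] st.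
pose e := enorm (vec x) * C * (b - a).
have e0 : 0 <= e by rewrite !mulr_ge0 ?enorm_ge0// subr_ge0 ltW.
pose p := `|dot (vec x) (tau t)|.
have p0 : 0 < p by rewrite normr_gt0; move: st; rewrite sgr_eq0.
pose N := Num.bound (e / p).
have hN : e < N%:R * p.
  by rewrite -ltr_pdivrMr// archi_boundP// divr_ge0// ltW.
apply: (@le_limn_einf _ _ _ N) => k Nk; rewrite lee_fin.
(* [node a b k i] is the last node up to t, hence within (b - a)/(k+1) of t. *)
pose i := Num.truncn ((t - a) / (b - a) * k.+1%:R).
have ba : 0 < b - a by rewrite subr_gt0.
have /andP[i1 i2] : i%:R <= (t - a) / (b - a) * k.+1%:R < i.+1%:R.
  by apply: Num.Theory.truncn_itv; rewrite mulr_ge0// divr_ge0// subr_ge0// ltW.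
have it : node a b k i <= t.
  rewrite /node -lerBrDl mulrC -ler_pdivlMr// ler_pdivrMr//.
have ti : t - node a b k i <= (b - a) / k.+1%:R.
  rewrite -(node_diff a b k i) lerB// /node -lerBlDl mulrC -ler_pdivrMr//.
  by rewrite ler_pdivlMr// ltW.
have ik : (i <= k.+1)%N.
  rewrite -(ler_nat R); apply: (le_trans i1).
  by rewrite ger_pMl// ler_pdivrMr// mul1r lerD2r.
have /andP[ai _] := node_itv (ltW ab) ik.
suff -> : side x (tau t) = side x (tau (node a b k i)) by exact: le_sampled_variation.
have d1 : enorm (tau t - tau (node a b k i)) <= C * ((b - a) / k.+1%:R).
  apply: le_trans (tauPhi ai it tb) _; apply: le_trans (PhiC ai it tb) _.
  by rewrite ler_wpM2l.
have d2 u : enorm u <= C * ((b - a) / k.+1%:R) -> dot (vec x) u < p.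
  move=> hu; apply: le_lt_trans (dot_le_enorm _ _) _.
  apply: (@le_lt_trans _ _ (e / k.+1%:R)).
    rewrite /e -!mulrA; apply: ler_wpM2l => //; exact: enorm_ge0.
  rewrite ltr_pdivrMr// (lt_le_trans hN)// [leLHS]mulrC ler_pM2l// ler_nat.
  exact: leqW.
have d3 := d2 _ d1.
have d4 : dot (vec x) (tau (node a b k i) - tau t) < p.
  by apply: d2; rewrite -enormN opprB.
move: d3 d4; rewrite !dotBr /side /p.
move: (dot _ (tau t)) (dot _ (tau (node a b k i))) => y z.
case: (ltgtP y 0) => [y0|y0|y0].
- by rewrite ltr0_norm// => h1 h2; rewrite !ltr0_sg//; lra.
- by rewrite gtr0_norm// => h1 h2; rewrite !gtr0_sg//; lra.
- by rewrite y0 normr0; lra.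
Qed.

(** Consecutive sample points have distance at most d, so that [lune_le] applies with
a uniform denominator, and the distances add up to at most Phi b - Phi a. *)
Lemma integral_sampled_variation k :
  let d := C * (b - a) / k.+1%:R in d <= 2^-1 ->
  (\int[lam]_(x in B) (sampled_variation tau a b k x)%:E <=
    (2 * V * (Phi b - Phi a) / (pi - 3 * d))%:E)%E.
Proof.
move=> d d2; have mB : measurable B by exact: measurable_unit_ball.
have pi2 := pi_ge2 R.
have den : 0 < pi - 3 * d by lra.
pose r (i : nat) := enorm (tau (node a b k i) - tau (node a b k i.+1)).
pose D (i : nat) := Phi (node a b k i.+1) - Phi (node a b k i).
have le_node (i : nat) : node a b k i <= node a b k i.+1.
  by rewrite -subr_ge0 node_diff divr_ge0// subr_ge0 ltW.
have V0 := ball_volume_gt0 R n.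
have step (i : 'I_k.+1) :
    (lune (tau (node a b k i)) (tau (node a b k i.+1)) <=
     (2 * V / (pi - 3 * d) * D i)%:E)%E.
  have /andP[ai ib] := node_itv (ltW ab) (ltnW (ltn_ord i)).
  have /andP[aj jb] := @node_itv a b k i.+1 (ltW ab) (ltn_ord i).
  have rD : r i <= D i.
    by rewrite /r -enormN opprB; exact: tauPhi.
  have Dd : D i <= d.
    by apply: (le_trans (PhiC ai (le_node i) jb)); rewrite node_diff mulrA.
  have r0 : 0 <= r i by exact: enorm_ge0.
  apply: le_trans (lune_le _ _ _) _.
  - by apply: tau1; rewrite ai ib.
  - by apply: tau1; rewrite aj jb.
  - by rewrite -/(r i); lra.
  rewrite lee_fin -/(r i) -!mulrA ler_pM2l// ler_pM2l// mulrC.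
  apply: ler_pM => //; first by rewrite invr_ge0; lra.
  by rewrite lef_pV2 ?posrE; lra.
under eq_integral do rewrite -sumEFin.
rewrite (@ge0_integral_sum _ _ _ lam B mB 'I_k.+1
  (fun i x => (`|side x (tau (node a b k i)) - side x (tau (node a b k i.+1))|)%:E)); last 2 first.
- by move=> i; apply: measurable_funTS; exact: measurable_side_diff.
- by move=> i x _; rewrite lee_fin.
apply: (@le_trans _ _ (\sum_(i < k.+1) (2 * V / (pi - 3 * d) * D i)%:E)%E).
  by apply: lee_sum => i _; exact: step.
rewrite sumEFin lee_fin -mulr_sumr -(big_mkord xpredT D) /D.
rewrite (@telescope_sumr _ 0 k.+1 (fun i => Phi (node a b k i)))//.
by rewrite node0 nodeS mulrAC.
Qed.

(** Fatou's lemma; the denominators pi - 3 d tend to pi. *)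
Lemma integral_side_variation :
  (\int[lam]_(x in B) side_variation tau a b x <=
    (2 * V / pi * (Phi b - Phi a))%:E)%E.
Proof.
have mB : measurable B by exact: measurable_unit_ball.
apply: (@le_trans _ _ (limn_einf (fun k =>
    \int[lam]_(x in B) (sampled_variation tau a b k x)%:E))%E).
  apply: fatou => //.
    move=> k; apply/measurable_EFinP/measurable_funTS.
    apply: measurable_sum => i; apply/measurable_EFinP.
    exact: measurable_side_diff.
  by move=> k x _; rewrite lee_fin; apply: sumr_ge0.
set K := Phi b - Phi a.
have K0 : 0 <= K by apply: le_trans (enorm_ge0 _) (tauPhi _ _ _) => //; exact: ltW.
have V0 := ball_volume_gt0 R n.
have pi2 := pi_ge2 R.
apply/lee_addgt0Pr => e e0; rewrite -EFinD.
apply: limn_einf_le => N.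
pose c := C * (b - a).
have c0 : 0 <= c by rewrite mulr_ge0// subr_ge0 ltW.
(* k + 1 >= M makes d = c / (k+1) at most 1/2, and the error 6 V K d at most e. *)
pose M := 2 * c + 6 * V * K * c / e.
have VK0 : 0 <= 6 * V * K by rewrite mulr_ge0// mulr_ge0// ltW.
have M1 : 0 <= 6 * V * K * c / e by rewrite divr_ge0 ?(ltW e0)// mulr_ge0.
have M0 : 0 <= M by rewrite addr_ge0// mulr_ge0.
exists (N + Num.bound M)%N; first exact: leq_addr.
set k := (N + _)%N; pose d := c / k.+1%:R.
have Mk : M <= k.+1%:R.
  apply: (@le_trans _ _ (Num.bound M)%:R); first by rewrite ltW// archi_boundP.
  by rewrite ler_nat /k leqW// leq_addl.
have d0 : 0 <= d by rewrite divr_ge0.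
have d2 : d <= 2^-1.
  rewrite ler_pdivrMr// ler_pdivlMl//.
  apply: le_trans Mk; by rewrite lerDl.
have dV : 6 * V * K * d <= e.
  rewrite /d mulrA ler_pdivrMr// -ler_pdivrMl// mulrC.
  by apply: le_trans Mk; rewrite lerDr mulr_ge0.
apply: (le_trans (integral_sampled_variation d2)); rewrite lee_fin -/d -/K.
have den : 2^-1 <= pi - 3 * d by lra.
rewrite -lerBlDl.
have -> : 2 * V * K / (pi - 3 * d) - 2 * V / pi * K =
   6 * V * K * d / (pi * (pi - 3 * d)).
  by field; rewrite !gt_eqF//; lra.
apply: le_trans dV; rewrite ler_pdivrMr; last by rewrite mulr_gt0//; lra.
rewrite ler_peMr//; first by rewrite mulr_ge0.
apply: (@le_trans _ _ (2 * 2^-1)); first by rewrite divff.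
by rewrite ler_pM// invr_ge0.
Qed.

End lipschitz.

End sign_variation.

(** * Derivative of the unit tangent *)

Section vector_calculus.
Context (R : realType) (n : nat).
Implicit Types (f g : R -> 'rV[R]_n) (t : R).

Lemma is_derive_coord f t i : derivable f t 1 ->
  is_derive t 1 (fun s => f s 0 i) (derive1 f t 0 i).
Proof.
move=> df; split; first by have /derivable_mxP := df; apply.
by rewrite derive1E derive_mx// mxE.
Qed.

Lemma is_derive_row f t (df : 'rV[R]_n) :
  (forall i, is_derive t 1 (fun s => f s 0 i) (df 0 i)) ->
  derivable f t 1 /\ derive1 f t = df.
Proof.
move=> h; have D : derivable f t 1.
  by apply/derivable_mxP => i j; rewrite ord1; exact: ex_derive.
split=> //; rewrite derive1E derive_mx//.
by apply/rowP => i; rewrite mxE; exact: derive_val.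
Qed.

Lemma is_derive_dot f g t : derivable f t 1 -> derivable g t 1 ->
  is_derive t 1 (fun s => dot (f s) (g s))
    (dot (f t) (derive1 g t) + dot (derive1 f t) (g t)).
Proof.
move=> df dg.
rewrite (_ : (fun s => _) =
    \sum_(i < n) ((fun s => f s 0 i) * (fun s => g s 0 i) : R -> R)); last first.
  by apply/funext => s; rewrite fct_sumE.
have h i : is_derive t (1 : R) ((fun s => f s 0 i) * (fun s => g s 0 i) : R -> R)
   (f t 0 i * derive1 g t 0 i + derive1 f t 0 i * g t 0 i).
  apply: (is_derive_eq (is_deriveM (is_derive_coord i df) (is_derive_coord i dg))).
  by rewrite [X in _ + X]mulrC.
by apply: (is_derive_eq (is_derive_sum h)); rewrite /dot -big_split.
Qed.

Lemma continuous_dot f g t : {for t, continuous f} -> {for t, continuous g} ->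
  {for t, continuous (fun s => dot (f s) (g s))}.
Proof.
move=> cf cg; apply: cvg_big => [|i _]; first exact: add_continuous.
have c (h : R -> 'rV[R]_n) : {for t, continuous h} ->
    h s 0 i @[s --> t] --> h t 0 i.
  by move=> ch; apply: (cvg_comp h (fun M : 'rV[R]_n => M 0 i) ch); exact: coord_continuous.
by apply: cvgM; exact: c.
Qed.

Lemma continuous_enorm f t : {for t, continuous f} ->
  {for t, continuous (fun s => enorm (f s))}.
Proof.
move=> cf; apply: (cvg_comp (fun s => dot (f s) (f s)) (@Num.sqrt R)).
  exact: continuous_dot.
exact: sqrt_continuous.
Qed.

(** The derivative of f / |f| when f = v and f' = w. *)
Definition unit_vec_derive (v w : 'rV[R]_n) : 'rV[R]_n :=
  (enorm v)^-1 *: (w - (dot v w / dot v v) *: v).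

Lemma derive_unit_vec f t : derivable f t 1 -> f t != 0 ->
  derivable (fun s => unit_vec (f s)) t 1 /\
  derive1 (fun s => unit_vec (f s)) t = unit_vec_derive (f t) (derive1 f t).
Proof.
move=> df ft0; apply: is_derive_row => i.
have d0 : 0 < dot (f t) (f t) by exact: dot_gt0.
have e0 : enorm (f t) != 0 by rewrite enorm_eq0.
have D1 := is_derive1_comp (is_derive1_sqrt d0) (is_derive_dot df df).
have D2 := is_deriveV (f := Num.sqrt \o (fun s => dot (f s) (f s))) e0 D1.
rewrite (_ : (fun s => _) = (fun s => (Num.sqrt (dot (f s) (f s)))^-1) *
    (fun s => f s 0 i)); last by apply/funext => s; rewrite mxE.
apply: (is_derive_eq (is_deriveM D2 (is_derive_coord i df))).
rewrite !mxE /= -/(enorm (f t)) (dotC (derive1 f t)) -enorm_sqr.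
rewrite /GRing.scale/=.
by field.
Qed.

Lemma continuous_unit_vec_derive f g t :
  {for t, continuous f} -> {for t, continuous g} -> f t != 0 ->
  {for t, continuous (fun s => unit_vec_derive (f s) (g s))}.
Proof.
move=> cf cg f0; apply: cvgZ; first by apply: cvgV; rewrite ?enorm_eq0//; exact: continuous_enorm.
apply: cvgB => //; apply: cvgZ => //; apply: cvgM; first exact: continuous_dot.
by apply: cvgV; rewrite ?dot_eq0//; exact: continuous_dot.
Qed.

End vector_calculus.

(** * Smooth arcs: total curvature, tangents, and heights *)

Lemma increment_diff_ge0 (R : realFieldType) (p q r s : R) :
  p - r <= q - s -> 0 <= q - p - (s - r).
Proof. lra. Qed.

Lemma increment_leZ (R : realFieldType) (k p q s t : R) :
  k * s - p <= k * t - q -> q - p <= k * (t - s).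
Proof. lra. Qed.

(** The unit tangent in the direction of motion along an arc which ends at b. At b
itself only the tangent from before is available, and it points backward. Being
defined from the curve alone, it avoids the choice of a C^2 extension. *)
Definition direction (R : realType) n (c : R -> 'rV[R]_n) (b t : R) :=
  if t < b then tangent_after c t else - tangent_before c t.

Section arc.
Context (R : realType).
Local Notation mu := (@lebesgue_measure R).

(** Used for the speed of the unit tangent: it turns the integral of the curvature into
an increment, which is additive over subdivisions. *)
Lemma exists_primitive (kappa : R -> R) (a b : R) : a < b ->
  (forall t, a <= t <= b -> {for t, continuous kappa}) ->
  exists Phi : R -> R, [/\ {within `[a, b], continuous Phi},
    forall t, t \in `]a, b[ -> is_derive t 1 Phi (kappa t) &
    (\int[mu]_(t in `]a, b[) (kappa t)%:E = (Phi b - Phi a)%:E)%E].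
Proof.
move=> ab ck.
have cw : {within `[a, b], continuous kappa}.
  by apply: continuous_in_subspaceT => t; rewrite inE /= in_itv /=; exact: ck.
have ik : mu.-integrable `[a, b] (EFin \o kappa).
  by apply: continuous_compact_integrable => //; exact: segment_compact.
exists (fun x => parameterized_integral mu a x kappa); split.
- by apply: parameterized_integral_continuous => //; exact: ltW.
- move=> t; rewrite in_itv/= => /andP[at_ tb].
  have [] := continuous_FTC1_closed tb ik at_ (ck t _); first by rewrite !ltW.
  by move=> d1 d2; split; [exact: d1|rewrite -derive1E; exact: d2].
- rewrite {2}/parameterized_integral set_itv1 Rintegral_set1 subr0.
  rewrite /parameterized_integral /Rintegral fineK; last exact: integrable_fin_num.
  rewrite (@integral_itv_bndoo _ a b _ true false)//.
  apply: (measurable_funS _ _ (measurable_int _ ik)) => //.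
  exact: subset_itv_oo_cc.
Qed.

Lemma le_of_derive_ge0 (f df : R -> R) (s t : R) : s <= t ->
  {within `[s, t], continuous f} ->
  (forall x, x \in `]s, t[ -> is_derive x 1 f (df x)) ->
  (forall x, s <= x <= t -> 0 <= df x) -> f s <= f t.
Proof.
move=> st cf fd df0; have [c + e] := MVT_segment st fd cf.
by rewrite in_itv/= => ct; rewrite -subr_ge0 e mulr_ge0 ?df0// subr_ge0.
Qed.

Lemma is_derive_mull (k x : R) : is_derive x 1 (fun y : R => k * y) k.
Proof.
apply: (is_derive_eq (is_deriveM (is_derive_cst k x 1) (is_derive_id x 1))).
by rewrite scaler0 addr0 /GRing.scale/= mulr1.
Qed.

Context (n : nat).

Section extension.
(** A regular C^2 arc c together with one of its C^2 extensions g: differentiating g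
avoids the endpoints of the arc. *)
Variables (c g : R -> 'rV[R]_n) (a b : R).
Hypothesis ab : a < b.
Hypothesis gC2 : class_C2 g.
Hypothesis cg : forall t, a <= t <= b -> c t = g t /\ derive1 g t != 0.

Let gam := derive1 g.
Let gam' := derive1 gam.

Let dg t : derivable g t 1. Proof. by case: gC2. Qed.
Let dgam t : derivable gam t 1. Proof. by case: gC2. Qed.
Let cgam' : continuous gam'. Proof. by case: gC2. Qed.
Let cgam : continuous gam.
Proof.
by move=> t; apply: differentiable_continuous; apply/derivable1_diffP.
Qed.
Let gam0 t : a <= t <= b -> gam t != 0. Proof. by move=> /cg[]. Qed.

Let tau t := unit_vec (gam t).
(** The speed of the unit tangent. *)
Let kappa t := enorm (unit_vec_derive (gam t) (gam' t)).

Let ckappa t : a <= t <= b -> {for t, continuous kappa}.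
Proof.
move=> tab; apply: continuous_enorm; apply: continuous_unit_vec_derive.
- exact: cgam.
- exact: cgam'.
- exact: gam0.
Qed.

Let is_derive_dot_cst (w : 'rV[R]_n) (h : R -> 'rV[R]_n) t : derivable h t 1 ->
  is_derive t 1 (fun s => dot w (h s)) (dot w (derive1 h t)).
Proof.
move=> dh; apply: (is_derive_eq (is_derive_dot (f := cst w) (derivable_cst _ _ _) dh)).
by rewrite derive1_cst dot0l addr0.
Qed.

Let nearab t : a < t -> t < b -> \forall s \near t, a <= s <= b.
Proof.
move=> at_ tb; have tab : t \in `]a, b[ by rewrite in_itv/= at_.
apply: filterS (near_in_itvoo tab) => s.
by rewrite in_itv/= => /andP[/ltW -> /ltW ->].
Qed.

Let nearE t : a < t -> t < b -> \forall s \near t, c s = g s.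
Proof.
by move=> at_ tb; have := nearab at_ tb; apply: filterS => s /cg[].
Qed.

Let derive1_cg t : a < t -> t < b -> derive1 c t = gam t.
Proof.
by move=> at_ tb; rewrite /gam !derive1E; apply: near_eq_derive; exact: nearE.
Qed.

Let curvature_speed t : a < t -> t < b ->
  curvature c t * enorm (derive1 c t) = kappa t.
Proof.
move=> at_ tb; have tab : a <= t <= b by rewrite !ltW.
rewrite /curvature derive1_cg// -mulrA mulVf ?mulr1 ?enorm_eq0 ?gam0//.
congr (enorm _).
rewrite derive1E (@near_eq_derive _ _ _ _ tau); last first.
  have : t \in `]a, b[ by rewrite in_itv/= at_.
  move/near_in_itvoo; apply: filterS => s; rewrite in_itv/= => /andP[as_ sb].
  by rewrite /tau derive1_cg.
rewrite -derive1E; exact: (derive_unit_vec (@dgam t) (gam0 tab)).2.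
Qed.

Lemma total_curvatureE :
  total_curvature c a b = (\int[mu]_(t in `]a, b[) (kappa t)%:E)%E.
Proof.
apply: eq_integral => t; rewrite inE/= in_itv/= => /andP[at_ tb].
congr EFin; exact: curvature_speed.
Qed.

(** The chord from tau s to tau t is the increment of <u, tau>, u its unit vector, and
<u, tau'> <= |tau'| = Phi'. *)
Lemma direction_lipschitz : exists Phi C,
  [/\ forall s t, a <= s -> s <= t -> t <= b -> enorm (tau t - tau s) <= Phi t - Phi s,
      forall s t, a <= s -> s <= t -> t <= b -> Phi t - Phi s <= C * (t - s) &
      total_curvature c a b = (Phi b - Phi a)%:E].
Proof.
have [Phi [cPhi dPhi intPhi]] := exists_primitive ab ckappa.
have ckw : {within `[a, b], continuous kappa}.
  by apply: continuous_in_subspaceT => t; rewrite inE /= in_itv /=; exact: ckappa.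
have [m + mmax] := EVT_max (ltW ab) ckw; rewrite in_itv/= => mab.
have sub s t : a <= s -> t <= b -> `[s, t] `<=` `[a, b].
  by move=> as_ tb; apply: subset_itvScc; rewrite bnd_simp.
exists Phi, (kappa m); split; last by rewrite total_curvatureE.
- move=> s t as_ st tb.
  (* When the chord is 0, so is u. *)
  pose u := unit_vec (tau t - tau s).
  have u1 : enorm u <= 1.
    have [e|e] := eqVneq (tau t - tau s) 0; last by rewrite enorm_unit_vec.
    by rewrite /u e /unit_vec scaler0 /enorm dot0l sqrtr0.
  have uE : enorm (tau t - tau s) = dot u (tau t - tau s).
    rewrite dotZl -enorm_sqr expr2 mulrA.
    have [->|e] := eqVneq (enorm (tau t - tau s)) 0; first by rewrite mulr0.
    by rewrite mulVf// mul1r.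
  rewrite uE dotBr -subr_ge0.
  pose F x := Phi x - dot u (tau x).
  have dtau x : s <= x <= t -> is_derive x 1 (fun x => dot u (tau x))
      (dot u (unit_vec_derive (gam x) (gam' x))).
    move=> /andP[sx xt].
    have xab : a <= x <= b by rewrite (le_trans as_ sx) (le_trans xt tb).
    have [d1 d2] := derive_unit_vec (@dgam x) (gam0 xab).
    by have := is_derive_dot_cst u d1; rewrite d2.
  suff : F s <= F t by exact: increment_diff_ge0.
  apply (@le_of_derive_ge0 F (fun x => kappa x - dot u (unit_vec_derive (gam x) (gam' x))) s t st).
  + have cF1 := continuous_subspaceW (sub s t as_ tb) cPhi.
    have cF2 : {within `[s, t], continuous (fun x => dot u (tau x))}.
      apply: continuous_in_subspaceT => x; rewrite inE/= in_itv/= => sxt.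
      apply: differentiable_continuous; apply/derivable1_diffP.
      by case: (dtau x sxt).
    by move=> x; exact: (cvgB (cF1 x) (cF2 x)).
  + move=> x; rewrite in_itv/= => /andP[sx xt]; apply: is_deriveB.
      by apply: dPhi; rewrite in_itv/= (le_lt_trans as_ sx) (lt_le_trans xt tb).
    by apply: dtau; rewrite !ltW.
  + move=> x sxt; rewrite subr_ge0; apply: (le_trans (dot_le_enorm _ _)).
    by rewrite -[leRHS]mul1r ler_wpM2r// enorm_ge0.
- move=> s t as_ st tb.
  pose F x := kappa m * x - Phi x.
  suff : F s <= F t by exact: increment_leZ.
  apply (@le_of_derive_ge0 F (fun x => kappa m - kappa x) s t st).
  + have cF1 := continuous_subspaceW (sub s t as_ tb) cPhi.
    have cF2 : {within `[s, t], continuous (fun x => kappa m * x)}.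
      by apply: continuous_subspaceT => x; exact: mulrl_continuous.
    by move=> x; exact: (cvgB (cF2 x) (cF1 x)).
  + move=> x; rewrite in_itv/= => /andP[sx xt]; apply: is_deriveB; last first.
      by apply: dPhi; rewrite in_itv/= (le_lt_trans as_ sx) (lt_le_trans xt tb).
    exact: is_derive_mull.
  + move=> x /andP[sx xt]; rewrite subr_ge0; apply: mmax.
    by rewrite in_itv/= (le_trans as_ sx) (le_trans xt tb).
Qed.

Let growth t : (h^-1 *: (g (t + h) - g t)) @[h --> 0^'] --> gam t.
Proof.
have := @dg t; rewrite /derivable => /cvgP; rewrite /gam derive1E => h.
rewrite (_ : (fun h => _) = (fun h => h^-1 *: ((g \o shift t) h%:A - g t))).
  exact: h.
by apply/funext => x /=; rewrite -[x%:A]/(x * 1) mulr1 [x + t]addrC.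
Qed.

Lemma tangent_afterE t : a <= t -> t < b -> tangent_after c t = tau t.
Proof.
move=> at_ tb; congr unit_vec; apply: cvg_lim => //.
have := cvg_dnbhs_at_right (@growth t); apply: cvg_trans.
apply: near_eq_cvg; near=> h.
have h0 : 0 < h by [].
have thb : h <= b - t.
  by near: h; apply: nbhs_right_le; rewrite subr_gt0.
have [-> _] : c t = g t /\ gam t != 0 by apply: cg; rewrite at_ ltW.
have [-> //] : c (t + h) = g (t + h) /\ gam (t + h) != 0.
apply: cg; apply/andP; split; last by rewrite -lerBrDl.
by rewrite (le_trans at_)// lerDl ltW.
Unshelve. all: by end_near. Qed.

Lemma tangent_beforeE t : a < t -> t <= b -> tangent_before c t = - tau t.
Proof.
move=> at_ tb; rewrite -unit_vecN; congr unit_vec; apply: cvg_lim => //.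
have := cvg_dnbhs_at_left (@growth t).
move=> /cvg_at_leftNP; rewrite oppr0 => /cvgN; apply: cvg_trans.
apply: near_eq_cvg; near=> h.
have h0 : 0 < h by [].
have thb : h <= t - a.
  by near: h; apply: nbhs_right_le; rewrite subr_gt0.
have [-> _] : c t = g t /\ gam t != 0 by apply: cg; rewrite tb ltW.
have [-> _] : c (t - h) = g (t - h) /\ gam (t - h) != 0.
  apply: cg; apply/andP; split; first by rewrite lerBrDr -lerBrDl.
  by rewrite (le_trans _ tb)// gerBl ltW.
by rewrite -[LHS]/(- ((- h)^-1 *: (g (t - h) - g t))) invrN scaleNr opprK.
Unshelve. all: by end_near. Qed.

Lemma directionE t : a <= t <= b -> direction c b t = tau t.
Proof.
move=> /andP[at_]; rewrite le_eqVlt /direction => /orP[/eqP ->|tb].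
  by rewrite ltxx tangent_beforeE// opprK.
by rewrite tb tangent_afterE.
Qed.

(** For the strict inequality: the height along w decreases near a at a positive
rate, and it does not increase later. *)
Lemma height_decreases (w : 'rV[R]_n) :
  (forall t, a <= t <= b -> dot w (direction c b t) <= 0) ->
  dot w (c b) <= dot w (c a) /\
  (dot w (direction c b a) < 0 -> dot w (c b) < dot w (c a)).
Proof.
move=> wd; pose F s := dot (- w) (g s).
have dF (x : R) : is_derive x (1 : R) F (dot (- w) (gam x)) by exact: is_derive_dot_cst.
have cF s t : {within `[s, t], continuous F}.
  apply: continuous_subspaceT => x; apply: differentiable_continuous.
  by apply/derivable1_diffP; case: (dF x).
have sgn t : a <= t <= b -> exists2 k, 0 < k &
    dot (- w) (gam t) = - (k * dot w (direction c b t)).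
  move=> tab; exists (enorm (gam t)); first by rewrite enorm_gt0 ?gam0.
  by rewrite directionE// dotZr mulrA divff ?enorm_eq0 ?gam0// mul1r dotNl.
have dF0 t : a <= t <= b -> 0 <= dot (- w) (gam t).
  by move=> tab; have [k k0 ->] := sgn t tab; rewrite oppr_ge0 pmulr_rle0// wd.
have mono s t : a <= s -> s <= t -> t <= b -> F s <= F t.
  move=> as_ st tb; apply (@le_of_derive_ge0 F (fun x => dot (- w) (gam x)) s t st).
  - exact: cF.
  - by move=> x _; exact: dF.
  - by move=> x /andP[sx xt]; apply: dF0; rewrite (le_trans as_ sx) (le_trans xt tb).
have aab : a <= a <= b by rewrite lexx ltW.
have bab : a <= b <= b by rewrite lexx ltW.
have FE t : a <= t <= b -> dot w (c t) = - F t.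
  by move=> tab; rewrite (cg tab).1 /F dotNl opprK.
rewrite !FE// lerN2 ltrN2; split; first exact: mono (ltW ab) _.
move=> wa; have [k k0 ka] := sgn a aab.
have Fa : 0 < dot (- w) (gam a) by rewrite ka oppr_gt0 pmulr_rlt0.
have cgw : {for a, continuous (fun s => dot (- w) (gam s))}.
  by apply: continuous_dot; [exact: cvg_cst|exact: cgam].
have /nbhs_ballP[e /= e0 eball] : \forall s \near a, 0 < dot (- w) (gam s).
  exact: (cvgr_gt _ cgw).
pose t1 := a + Num.min (e / 2) (b - a).
have at1 : a < t1 by rewrite ltrDl lt_min divr_gt0//= subr_gt0.
have t1b : t1 <= b by rewrite -lerBrDl ge_min lexx orbT.
apply: lt_le_trans (mono t1 b (ltW at1) t1b (lexx b)).
have [x + e1] := MVT at1 (fun x _ => dF x) (@cF a t1).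
rewrite in_itv/= => /andP[ax xt1]; rewrite -subr_gt0 e1.
apply: mulr_gt0; last by rewrite subr_gt0.
apply: eball; rewrite /ball/= ltr0_norm ?subr_lt0// opprB ltrBlDl.
apply: (lt_le_trans xt1); rewrite lerD2l ge_min; apply/orP; left.
by rewrite ger_pMr// invf_le1// ler1n.
Qed.

Lemma direction_lipschitz_arc : exists Phi C,
  [/\ forall t, a <= t <= b -> enorm (direction c b t) = 1,
      forall s t, a <= s -> s <= t -> t <= b ->
        enorm (direction c b t - direction c b s) <= Phi t - Phi s,
      forall s t, a <= s -> s <= t -> t <= b -> Phi t - Phi s <= C * (t - s) &
      total_curvature c a b = (Phi b - Phi a)%:E].
Proof.
have [Phi [C [h1 h2 h3]]] := direction_lipschitz.
exists Phi, C; split=> [t tab|s t as_ st tb||].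
- by rewrite directionE//; apply: enorm_unit_vec; exact: gam0.
- rewrite !directionE; [exact: h1|by rewrite as_ (le_trans st)|].
  by rewrite (le_trans as_ st).
- exact: h2.
- exact: h3.
Qed.

End extension.

Variables (c : R -> 'rV[R]_n) (a b : R).
Hypotheses (ab : a < b) (arc : regular_C2_arc c a b).
Local Notation V := (ball_volume R n).
Local Notation lam := (lebesgue_tuple R n).
Local Notation B := (@unit_ball R n).
Local Notation dir := (direction c b).

Lemma arc_height_decreases (w : 'rV[R]_n) :
  (forall t, a <= t <= b -> dot w (dir t) <= 0) ->
  dot w (c b) <= dot w (c a) /\
  (dot w (dir a) < 0 -> dot w (c b) < dot w (c a)).
Proof. by case: arc => g gC2 cg; exact: height_decreases gC2 cg w. Qed.

Lemma arc_side_variation_through t x sigma : a <= t <= b ->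
  side x (dir t) = sigma -> sigma != 0 ->
  ((`|side x (dir a) - sigma| + `|sigma - side x (dir b)|)%:E
    <= side_variation dir a b x)%E.
Proof.
case: arc => g gC2 cg; have [Phi [C [h1 h2 h3 _]]] := direction_lipschitz_arc ab gC2 cg.
move=> tab <-; exact: (side_variation_through ab h2 h3).
Qed.

Lemma enorm_direction t : a <= t <= b -> enorm (dir t) = 1.
Proof.
case: arc => g gC2 cg; have [Phi [C [h _ _ _]]] := direction_lipschitz_arc ab gC2 cg.
exact: h.
Qed.

(** Crofton's inequality for one arc, whose total curvature is the length of the curve
described by its unit tangent. *)
Lemma total_curvature_ge : ((pi / 2 / V)%:E *
  \int[lam]_(x in B) side_variation dir a b x <= total_curvature c a b)%E.
Proof.
case: arc => g gC2 cg; have [Phi [C [h1 h2 h3 ->]]] := direction_lipschitz_arc ab gC2 cg.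
have V0 := ball_volume_gt0 R n.
have p0 := pi_gt0 R.
have k0 : 0 < pi / 2 / V by rewrite !divr_gt0.
rewrite (_ : Phi b - Phi a = pi / 2 / V * (2 * V / pi * (Phi b - Phi a))); last first.
  move: (pi : R) p0 => p p0.
  by field; rewrite !lt0r_neq0.
rewrite [leRHS]EFinM lee_pmul2l//; exact: (integral_side_variation ab h1 h2 h3).
Qed.

End arc.

(** * Sign count along one edge *)

Section detours.
Context (R : realDomainType).
Implicit Types u v w z sigma : R.

(** Triangle inequalities for the signs along an edge with a cut point. Here u is
the sign of the tangent at the start, z the one at the end; v and w are those of the
two tangents at the cut. The vectors for v and z point backward, so that the signs
of the motion are - v and - z. *)
Lemma detour_ends u v w z : `|u + z| <= `|v + w| + `|u + v| + `|w + z|.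
Proof.
rewrite [u + z](_ : _ = (u + v) - (v + w) + (w + z)); last by ring.
by rewrite (le_trans (ler_normD _ _))// lerD2r [leRHS]addrC; exact: ler_normB.
Qed.

Lemma detour_first u v w z sigma : `|u - sigma| + `|sigma + z| <=
  `|v + w| + (`|u - sigma| + `|sigma + v|) + `|w + z|.
Proof. by have := detour_ends sigma v w z; lra. Qed.

Lemma detour_later u v w z sigma : `|u - sigma| + `|sigma + z| <=
  `|v + w| + `|u + v| + (`|w - sigma| + `|sigma + z|).
Proof. by rewrite addrA lerD2r; exact: detour_ends. Qed.

(** Each end contributes at least 1: for instance sigma u + |u - sigma| is
sigma u + |1 - sigma u|. *)
Lemma detour_gain u z sigma : sigma = 1 \/ sigma = -1 ->
  2 <= sigma * u - sigma * z + (`|u - sigma| + `|sigma + z|).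
Proof.
case=> ->.
  have := ler_norm (1 - u); have := ler_norm (1 + z); rewrite (distrC 1 u); lra.
have := ler_norm (u - -1); have := lerNnormlW (lexx `|-1 + z|); lra.
Qed.

End detours.

Section edge.
Context (R : realType) (n : nat).
Local Notation T := (n.-tuple (measurableTypeR R)).
Local Notation vec := (@vec_of_tuple R n).
Implicit Types (c : R -> 'rV[R]_n) (s : seq R) (x : T).

Definition piecewise_arc c a s z :=
  path <%R a (rcons s z) /\
  forall p q, (p, q) \in zip (a :: s) (rcons s z) -> regular_C2_arc c p q.

(** Each break of direction at a cut counts like a sign change inside a piece. The
tangent before a cut points backward, whence the sum and not the difference. *)
Definition edge_variation c a s z x : \bar R :=
  (\sum_(t <- s) (`|side x (tangent_before c t) + side x (tangent_after c t)|)%:E +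
   \sum_(p <- zip (a :: s) (rcons s z)) side_variation (direction c p.2) p.1 p.2 x)%E.

Definition edge_reaches c a s z x (sigma : R) :=
  exists p q t, [/\ (p, q) \in zip (a :: s) (rcons s z), p <= t <= q &
    side x (direction c q t) = sigma].

Lemma piecewise_arc_cons c a t s z : piecewise_arc c a (t :: s) z ->
  [/\ a < t, regular_C2_arc c a t & piecewise_arc c t s z].
Proof.
move=> [/= /andP[at_ ps] arcs]; split=> //.
  by apply: arcs; rewrite /= inE eqxx.
by split=> // p q pq; apply: arcs; rewrite /= inE pq orbT.
Qed.

Lemma piecewise_arc_nil c a z : piecewise_arc c a [::] z ->
  a < z /\ regular_C2_arc c a z.
Proof.
move=> [/= /andP[az _] arcs]; split=> //.
by apply: arcs; rewrite /= inE eqxx.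
Qed.

Lemma edge_variation_cons c a t s z x : edge_variation c a (t :: s) z x =
  ((`|side x (tangent_before c t) + side x (tangent_after c t)|)%:E +
   side_variation (direction c t) a t x + edge_variation c t s z x)%E.
Proof. by rewrite /edge_variation /= !big_cons/= addeACA. Qed.

Lemma edge_variation_nil c a z x :
  edge_variation c a [::] z x = side_variation (direction c z) a z x.
Proof. by rewrite /edge_variation /= big_nil big_cons big_nil adde0 add0e. Qed.

Lemma direction_first c a z : a < z -> direction c z a = tangent_after c a.
Proof. by rewrite /direction => ->. Qed.

Lemma direction_last c z : direction c z z = - tangent_before c z.
Proof. by rewrite /direction ltxx. Qed.

Lemma edge_variation_ends c a s z x : piecewise_arc c a s z ->
  ((`|side x (tangent_after c a) + side x (tangent_before c z)|)%:E
    <= edge_variation c a s z x)%E.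
Proof.
elim: s a => [|t s IH] a.
  move/piecewise_arc_nil => [az _]; rewrite edge_variation_nil.
  have := side_variation_ends (direction c z) a z x.
  by rewrite direction_first// direction_last sideN opprK.
move/piecewise_arc_cons => [at_ _ /IH h]; rewrite edge_variation_cons.
have := side_variation_ends (direction c t) a t x.
rewrite direction_first// direction_last sideN opprK => h'.
apply: le_trans (leeD (leeD (lexx _) h') h); rewrite -!EFinD lee_fin.
exact: detour_ends.
Qed.

Lemma edge_variation_reaches c a s z x sigma : piecewise_arc c a s z ->
  sigma != 0 -> edge_reaches c a s z x sigma ->
  ((`|side x (tangent_after c a) - sigma| +
    `|sigma + side x (tangent_before c z)|)%:E <= edge_variation c a s z x)%E.
Proof.
move=> + s0; elim: s a => [|t s IH] a.
  move/piecewise_arc_nil => [az arc] [p [q [t [/=]]]].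
  rewrite inE => /eqP[-> ->] pt st; rewrite edge_variation_nil.
  have := arc_side_variation_through az arc pt st s0.
  by rewrite direction_first// direction_last sideN opprK.
move/piecewise_arc_cons => [at_ arc arcs] [p [q [r [/=]]]].
rewrite inE edge_variation_cons => /orP[/eqP[-> ->] ar sr|pq pr sr].
  have := arc_side_variation_through at_ arc ar sr s0.
  rewrite direction_first// direction_last sideN opprK => h.
  have h' := edge_variation_ends x arcs.
  apply: le_trans (leeD (leeD (lexx _) h) h'); rewrite -!EFinD lee_fin.
  exact: detour_first.
have h := IH t arcs (ex_intro _ p (ex_intro _ q (ex_intro _ r (And3 pq pr sr)))).
have := side_variation_ends (direction c t) a t x.
rewrite direction_first// direction_last sideN opprK => h'.
apply: le_trans (leeD (leeD (lexx _) h') h); rewrite -!EFinD lee_fin.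
exact: detour_later.
Qed.

Lemma edge_height_decreases c a s z (w : 'rV[R]_n) : piecewise_arc c a s z ->
  (forall p q t, (p, q) \in zip (a :: s) (rcons s z) -> p <= t <= q ->
    dot w (direction c q t) <= 0) ->
  dot w (c z) <= dot w (c a) /\
  (dot w (tangent_after c a) < 0 -> dot w (c z) < dot w (c a)).
Proof.
elim: s a => [|t s IH] a.
  move/piecewise_arc_nil => [az arc] h.
  rewrite -(direction_first c az); apply: arc_height_decreases => // t.
  by apply: (h a z); rewrite /= inE.
move/piecewise_arc_cons => [at_ arc arcs] h.
have [|h1 h2] := @arc_height_decreases _ _ c a t at_ arc w.
  by move=> r; apply: (h a t); rewrite /= inE eqxx.
have [|h3 _] := IH t arcs.
  by move=> p q r pq; apply: h; rewrite /= inE pq orbT.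
rewrite -(direction_first c at_); split; first exact: le_trans h1.
by move=> /h2; exact: le_lt_trans.
Qed.

(** If the edge moves somewhere with sign sigma, [detour_gain] applies. Otherwise the
height, multiplied by sigma, would decrease along the edge, and strictly at its
start, where the sign is not 0; but it does not decrease from one end to the
other. *)
Lemma edge_count_ge2 c a s z x (sigma : R) : piecewise_arc c a s z ->
  sigma = 1 \/ sigma = -1 ->
  side x (tangent_after c a) != 0 ->
  0 <= sigma * (dot (vec x) (c z) - dot (vec x) (c a)) ->
  (2%:E <= (sigma * side x (tangent_after c a) - sigma * side x (tangent_before c z))%:E
    + edge_variation c a s z x)%E.
Proof.
move=> arcs s1 sa hz.
have [reach|nreach] := pselect (edge_reaches c a s z x sigma).
  have s0 : sigma != 0 by case: s1 => ->; rewrite ?oppr_eq0 oner_eq0.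
  have h := edge_variation_reaches arcs s0 reach.
  apply: le_trans (leeD (lexx _) h); rewrite -EFinD lee_fin.
  exact: detour_gain.
exfalso.
have nonpos p q t : (p, q) \in zip (a :: s) (rcons s z) -> p <= t <= q ->
    dot (sigma *: vec x) (direction c q t) <= 0.
  move=> pq pt; rewrite leNgt; apply/negP => pos; apply: nreach.
  exists p, q, t; split=> //; move: pos; rewrite dotZl /side.
  case: s1 => ->; rewrite ?mul1r ?mulN1r ?oppr_gt0 => ?.
    by rewrite gtr0_sg.
  by rewrite ltr0_sg.
have [_ strict] := edge_height_decreases arcs nonpos.
have aneg : dot (sigma *: vec x) (tangent_after c a) < 0.
  have [q hq] : exists q, (a, q) \in zip (a :: s) (rcons s z) /\ a < q.
    case: (s) arcs => [|t s'] [/= /andP[aq _] _]; [exists z|exists t];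
    by rewrite inE eqxx.
  case: hq => hq aq.
  have aaq : a <= a <= q by rewrite lexx ltW.
  have := nonpos _ _ _ hq aaq; rewrite direction_first// le_eqVlt => /orP[|//].
  rewrite dotZl mulf_eq0 => /orP[/eqP e|e].
    by case: s1 => h; move: e; rewrite h => /eqP; rewrite ?oppr_eq0 oner_eq0.
  by move: sa; rewrite /side sgr_eq0 e.
have := strict aneg; rewrite !dotZl -subr_lt0 -mulrBr => hlt.
by move: hz; rewrite leNgt hlt.
Qed.

End edge.

(** * The net total curvature as an average of sign counts *)

Lemma zip_path_lt (R : realType) (a z p q : R) s :
  path <%R a (rcons s z) -> (p, q) \in zip (a :: s) (rcons s z) -> p < q.
Proof.
elim: s a => [|t s IH] a /=; first by rewrite andbT inE => az /eqP[-> ->].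
by move=> /andP[at_ ps]; rewrite inE => /orP[/eqP[-> ->]//|]; exact: IH.
Qed.

Section lower_bound.
Context (R : realType) (G : graph) (n : nat) (f : mapping R G n).
Local Notation T := (n.-tuple (measurableTypeR R)).
Local Notation lam := (lebesgue_tuple R n).
Local Notation vec := (@vec_of_tuple R n).
Local Notation B := (@unit_ball R n).
Local Notation V := (ball_volume R n).
(* The factor pi/2, divided by the volume of the ball to form averages over it. *)
Local Notation weight := ((pi / 2 / V : R)%:E).

Lemma mapping_piecewise_arc e : piecewise_arc (emap f e) 0 (cuts f e) 1.
Proof. by split; [exact: cuts_sorted|move=> p q; exact: emap_C2]. Qed.

Definition vertex_count (x : T) : \bar R :=
  (\sum_(q : vertex G) (`|\sum_(u <- star f q) side x u|)%:E)%E.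

Definition edge_count (x : T) : \bar R :=
  (\sum_(e : edge G) edge_variation (emap f e) 0 (cuts f e) 1 x)%E.

Let abs_sides (us : seq 'rV[R]_n) (x : T) : \bar R := (`|\sum_(u <- us) side x u|)%:E.

Let measurable_abs_sides us : measurable_fun B (abs_sides us).
Proof.
apply: measurable_funTS; apply/measurable_EFinP; apply: measurableT_comp => //.
by apply: measurable_sum => u; exact: measurable_side.
Qed.

Let abs_sides_ge0 us x : (0 <= abs_sides us x)%E.
Proof. by rewrite lee_fin. Qed.

Let mB : measurable B. Proof. exact: measurable_unit_ball. Qed.

Let weight_ge0 : (0 <= weight)%E.
Proof. by rewrite lee_fin divr_ge0 ?divr_ge0 ?pi_ge0// ltW// ball_volume_gt0. Qed.

Let weight_integral_sum (I : Type) (r : seq I) (F : I -> T -> \bar R) :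
  (forall i, measurable_fun B (F i)) -> (forall i x, (0 <= F i x)%E) ->
  (weight * \int[lam]_(x in B) \sum_(i <- r) F i x =
   \sum_(i <- r) (weight * \int[lam]_(x in B) F i x))%E.
Proof.
move=> mF F0; rewrite ge0_integral_sum// ge0_sume_distrr//.
by move=> i _; exact: integral_ge0.
Qed.

Let cut_count c s (x : T) : \bar R :=
  (\sum_(t <- s) abs_sides [:: tangent_before c t; tangent_after c t] x)%E.

Let piece_count c s (x : T) : \bar R :=
  (\sum_(p <- zip (0%R :: s) (rcons s 1%R)) side_variation (direction c p.2) p.1 p.2 x)%E.

Let edge_variationE e x : edge_variation (emap f e) 0 (cuts f e) 1 x =
  (cut_count (emap f e) (cuts f e) x + piece_count (emap f e) (cuts f e) x)%E.
Proof.
congr (_ + _)%E; apply: eq_bigr => t _.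
by rewrite /abs_sides big_cons big_seq1.
Qed.

Let measurable_cut_count c s : measurable_fun B (cut_count c s).
Proof. by apply: emeasurable_sum => t; exact: measurable_abs_sides. Qed.

Let measurable_piece_count c s : measurable_fun B (piece_count c s).
Proof.
apply: emeasurable_sum => t; apply: measurable_funTS.
exact: measurable_side_variation.
Qed.

Let cut_count_ge0 c s x : (0 <= cut_count c s x)%E.
Proof. by apply: sume_ge0 => t _; exact: abs_sides_ge0. Qed.

Let piece_count_ge0 c s x : (0 <= piece_count c s x)%E.
Proof. by apply: sume_ge0 => t _; exact: side_variation_ge0. Qed.

Let measurable_vertex_count : measurable_fun B vertex_count.
Proof. by apply: emeasurable_sum => t; exact: measurable_abs_sides. Qed.

Let measurable_edge_variation e :
  measurable_fun B (edge_variation (emap f e) 0 (cuts f e) 1).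
Proof.
rewrite (_ : edge_variation _ _ _ _ = fun x =>
  (cut_count (emap f e) (cuts f e) x + piece_count (emap f e) (cuts f e) x)%E).
  by apply: emeasurable_funD.
by apply/funext => x; exact: edge_variationE.
Qed.

Let edge_variation_ge0 e x : (0 <= edge_variation (emap f e) 0 (cuts f e) 1 x)%E.
Proof. by rewrite edge_variationE adde_ge0. Qed.

Lemma measurable_count : measurable_fun B (fun x => vertex_count x + edge_count x)%E.
Proof.
by apply: emeasurable_funD => //; apply: emeasurable_sum.
Qed.

Lemma count_ge0 x : (0 <= vertex_count x + edge_count x)%E.
Proof.
apply: adde_ge0; first by apply: sume_ge0 => q _; exact: abs_sides_ge0.
by apply: sume_ge0 => e _; exact: edge_variation_ge0.
Qed.

(** Term by term: equality at the vertices and at the cuts, Crofton's inequality for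
the pieces. *)
Lemma NTC_ge_average : (weight *
  \int[lam]_(x in B) (vertex_count x + edge_count x) <= NTC f)%E.
Proof.
rewrite ge0_integralD//; last 3 first.
- by move=> x _; apply: sume_ge0 => q _; exact: abs_sides_ge0.
- by move=> x _; apply: sume_ge0 => e _; exact: edge_variation_ge0.
- by apply: emeasurable_sum.
rewrite ge0_muleDr; last 2 first.
- apply: integral_ge0 => x _.
  by apply: sume_ge0 => q _; exact: abs_sides_ge0.
- apply: integral_ge0 => x _.
  by apply: sume_ge0 => e _; exact: edge_variation_ge0.
rewrite /NTC -addeA; apply: leeD.
  rewrite (@weight_integral_sum _ _ (fun q => abs_sides (star f q)))//.
  by apply: lee_sum => q _; rewrite ntcE.
rewrite /edge_count weight_integral_sum// -big_split/=.
apply: lee_sum => e _.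
under eq_integral do rewrite edge_variationE.
rewrite ge0_integralD// ge0_muleDr; last 2 first.
- exact: integral_ge0.
- exact: integral_ge0.
apply: leeD.
  rewrite (@weight_integral_sum _ _ (fun t => abs_sides
    [:: tangent_before (emap f e) t; tangent_after (emap f e) t]))//.
  by apply: lee_sum => t _; rewrite ntcE.
rewrite weight_integral_sum//; last 2 first.
- by move=> p; apply: measurable_funTS; exact: measurable_side_variation.
- by move=> p x; exact: side_variation_ge0.
have [sorted arcs] := mapping_piecewise_arc e.
rewrite /pieces !big_seq; apply: lee_sum => -[p q] pq /=.
apply: total_curvature_ge; first exact: zip_path_lt sorted pq.
exact: arcs.
Qed.

End lower_bound.

(** * Theta graphs: the lower bound *)

Lemma sum_map_enum (R : realType) (V : Type) m (g : 'I_m -> V) (F : V -> R) :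
  \sum_(u <- [seq g e | e <- enum 'I_m]) F u = \sum_e F (g e).
Proof. by rewrite big_map big_enum. Qed.

Lemma signed_sums_le (R : realDomainType) m (A Z : 'I_m -> R) (sigma : R) :
  sigma = 1 \/ sigma = -1 ->
  \sum_e (sigma * A e - sigma * Z e) <= `|\sum_e A e| + `|\sum_e Z e|.
Proof.
move=> s1; rewrite sumrB -!mulr_sumr.
have habs (y : R) : sigma * y <= `|y| /\ - (sigma * y) <= `|y|.
  by case: s1 => ->; rewrite ?mul1r ?mulN1r ?opprK; split;
    rewrite ?ler_norm// -normrN ler_norm.
by apply: lerD; [exact: (habs _).1|exact: (habs _).2].
Qed.

Section theta_lower.
Context (R : realType) (m n : nat) (f : mapping R (theta m) n).
Local Notation T := (n.-tuple (measurableTypeR R)).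
Local Notation lam := (lebesgue_tuple R n).
Local Notation vec := (@vec_of_tuple R n).
Local Notation B := (@unit_ball R n).
Local Notation V := (ball_volume R n).

Lemma star_source : star f true = [seq tangent_after (emap f e) 0 | e <- enum 'I_m].
Proof.
rewrite /star (eq_filter (a2 := predT)) ?filter_predT//.
by rewrite (eq_filter (a2 := pred0)) ?filter_pred0 ?cats0.
Qed.

Lemma star_target : star f false = [seq tangent_before (emap f e) 1 | e <- enum 'I_m].
Proof.
rewrite /star (eq_filter (a2 := pred0)) ?filter_pred0//.
by rewrite (eq_filter (a2 := predT)) ?filter_predT.
Qed.

(** With the same sigma for all edges, the absolute values of the two vertex sums are
bounded below by sums over the edges, and each edge contributes 2. *)
Lemma theta_count_ge (x : T) :
  (forall e : 'I_m, side x (tangent_after (emap f e) 0) != 0) ->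
  ((2 * m%:R)%:E <= vertex_count f x + edge_count f x)%E.
Proof.
move=> gen.
pose h b := dot (vec x) (vmap f b).
pose sigma : R := if h true <= h false then 1 else -1.
have s1 : sigma = 1 \/ sigma = -1 by rewrite /sigma; case: ifP; [left|right].
have sh : 0 <= sigma * (h false - h true).
  rewrite /sigma; case: ifPn => hh; first by rewrite mul1r subr_ge0.
  by rewrite mulN1r opprB subr_ge0 ltW// ltNge.
pose A (e : 'I_m) := side x (tangent_after (emap f e) 0).
pose Z (e : 'I_m) := side x (tangent_before (emap f e) 1).
have edge (e : 'I_m) : (2%:E <= (sigma * A e - sigma * Z e)%:E +
    edge_variation (emap f e) 0 (cuts f e) 1 x)%E.
  apply: edge_count_ge2 => //; first exact: mapping_piecewise_arc.
  by rewrite emap_target emap_source.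
have -> : vertex_count f x = (`|\sum_e A e| + `|\sum_e Z e|)%:E.
  rewrite EFinD; transitivity ((`|\sum_(u <- star f true) side x u|)%:E +
    (`|\sum_(u <- star f false) side x u|)%:E)%E; first exact: big_bool.
  rewrite star_source star_target !sum_map_enum; reflexivity.
apply: (@le_trans _ _ (\sum_(e < m) ((sigma * A e - sigma * Z e)%:E +
    edge_variation (emap f e) 0 (cuts f e) 1 x))%E).
  apply: (@le_trans _ _ (\sum_(e < m) 2%:E)%E); last by apply: lee_sum => e _.
  by rewrite sumEFin lee_fin sumr_const card_ord mulr_natr.
rewrite big_split/=; apply: leeD; last exact: lexx.
by rewrite sumEFin lee_fin; exact: signed_sums_le.
Qed.

Lemma tangent_after_neq0 (e : 'I_m) : tangent_after (emap f e) 0 != 0.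
Proof.
have [sorted arcs] := mapping_piecewise_arc f e.
have [q hq] : exists q, (0, q) \in zip (0 :: cuts f e) (rcons (cuts f e) 1).
  by case: (cuts f e) => [|t s]; [exists 1|exists t]; rewrite inE eqxx.
have q0 := zip_path_lt sorted hq.
rewrite -(direction_first _ q0) -enorm_eq0.
by rewrite (enorm_direction q0 (arcs _ _ hq)) ?oner_eq0// lexx ltW.
Qed.

(** Almost every x is generic: the hyperplanes orthogonal to the m initial tangents are
null sets. *)
Lemma theta_NTC_ge : ((m%:R * pi)%:E <= NTC f)%E.
Proof.
apply: le_trans (NTC_ge_average f).
have V0 := ball_volume_gt0 R n.
have mB : measurable B by exact: measurable_unit_ball.
rewrite [X in (X <= _)%E](_ : _ = ((pi / 2 / V)%:E *
    \int[lam]_(x in B) (cst (2 * m%:R)%:E) x)%E); last first.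
  rewrite integral_cst// [X in (_ * (_ * X))%E]ball_volumeE -!EFinM; congr EFin.
  move: (pi : R) => p; field.
  by rewrite lt0r_neq0.
apply: lee_wpmul2l.
  by rewrite lee_fin divr_ge0 ?divr_ge0 ?pi_ge0// ltW.
apply: ae_ge0_le_integral => //.
- by move=> x _; rewrite lee_fin mulr_ge0.
- by move=> x _; exact: count_ge0.
- exact: measurable_count.
have gen : {ae lam, forall x, forall e : 'I_m,
    side x (tangent_after (emap f e) 0) != 0}.
  apply: filter_forall => e.
  exists [set x : T | dot (vec x) (tangent_after (emap f e) 0) = 0]; split.
  - exact: measurable_hyperplane.
  - exact/hyperplane_null/tangent_after_neq0.
  - by move=> x /= /negP; rewrite negbK sgr_eq0 => /eqP.
by apply: filterS gen => x gx _; exact: theta_count_ge.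
Qed.

End theta_lower.

(** * Theta graphs: the bound is attained by a flat mapping *)

Lemma const_mx1_neq0 (R : realType) : (const_mx 1 : 'rV[R]_1) != 0.
Proof.
apply/eqP => h; have : (const_mx 1 : 'rV[R]_1) 0 0 = (0 : 'rV[R]_1) 0 0.
  by rewrite h.
by rewrite [LHS]mxE [RHS]mxE => /eqP; rewrite oner_eq0.
Qed.

Section theta_upper.
Context (R : realType) (m : nat).

Let seg (t : R) : 'rV[R]_1 := const_mx t.

Let derive_seg t : derivable seg t 1 /\ derive1 seg t = const_mx 1.
Proof.
apply: is_derive_row => i; rewrite mxE.
rewrite (_ : (fun s => seg s 0 i) = id); first exact: is_derive_id.
by apply/funext => s; rewrite mxE.
Qed.

Let derive1_seg : derive1 seg = fun=> const_mx 1.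
Proof. by apply/funext => t; exact: (derive_seg t).2. Qed.

Let seg_C2 : class_C2 seg.
Proof.
split; first by move=> t; case: (derive_seg t).
  by rewrite derive1_seg => t; exact: derivable_cst.
rewrite derive1_seg (_ : derive1 _ = fun=> 0); first exact: cst_continuous.
by apply/funext => t; rewrite derive1_cst.
Qed.

Let seg_arc : regular_C2_arc seg 0 1.
Proof.
exists seg; first exact: seg_C2.
move=> t _; split=> //; rewrite derive1_seg.
exact: const_mx1_neq0.
Qed.

Let flat_source (e : 'I_m) : seg 0 = seg (~~ true)%:R. Proof. by []. Qed.
Let flat_target (e : 'I_m) : seg 1 = seg (~~ false)%:R. Proof. by []. Qed.
Let flat_sorted (e : 'I_m) : path <%R (0 : R) (rcons [::] 1).
Proof. by rewrite /= ltr01. Qed.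
Let flat_C2 (e : 'I_m) (a b : R) :
  (a, b) \in zip [:: 0 : R] (rcons [::] 1) -> regular_C2_arc seg a b.
Proof. by rewrite inE => /eqP[-> ->]; exact: seg_arc. Qed.

(** All the edges run along [0, 1] in R^1, with q+ at 0 and q- at 1. *)
Definition flat_theta : mapping R (theta m) 1 :=
  @Mapping R (theta m) 1 (fun q : bool => seg (~~ q)%:R) (fun=> seg) (fun=> [::])
    flat_source flat_target flat_sorted flat_C2.

(** A sum of d signs has absolute value at most d. *)
Lemma ntc_le (us : seq 'rV[R]_1) :
  (ntc us <= ((size us)%:R * (pi / 2))%:E)%E.
Proof.
have V0 := ball_volume_gt0 R 1.
have mB : measurable (@unit_ball R 1) by exact: measurable_unit_ball.
rewrite ntcE.
apply: (@le_trans _ _ ((pi / 2 / ball_volume R 1)%:E *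
   \int[lebesgue_tuple R 1]_(x in @unit_ball R 1) (cst (size us)%:R%:E) x)%E).
  apply: lee_wpmul2l.
    by rewrite lee_fin divr_ge0 ?divr_ge0 ?pi_ge0// ltW.
  apply: ge0_le_integral => //.
  - apply: measurable_funTS; apply/measurable_EFinP; apply: measurableT_comp => //.
    by apply: measurable_sum => u; exact: measurable_side.
  - move=> x _; rewrite lee_fin; apply: (le_trans (ler_norm_sum _ _ _)).
    apply: (@le_trans _ _ (\sum_(u <- us) 1)).
      apply: ler_sum => u _; rewrite ler_norml; exact: sgr_bound.
    by rewrite big_const_seq count_predT iter_addr_0.
rewrite integral_cst// [X in (_ * (_ * X))%E]ball_volumeE -!EFinM lee_fin.
rewrite le_eqVlt; apply/orP; left; apply/eqP.
move: (pi : R) => p; field.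
by rewrite lt0r_neq0.
Qed.

Lemma flat_theta_NTC : (NTC flat_theta <= (m%:R * pi)%:E)%E.
Proof.
rewrite /NTC [X in (_ + _ + X)%E]big1 ?adde0; last first.
  move=> e _; rewrite /pieces/= big_cons big_nil adde0 /=.
  apply: integral0_eq => t; rewrite /= in_itv/= => tin.
  rewrite /curvature derive1_seg derive1_cst.
  by rewrite /enorm dot0l sqrtr0 !mul0r.
rewrite [X in (_ + X)%E]big1 ?adde0; last by move=> e _; rewrite big_nil.
rewrite big_bool star_source star_target /=.
apply: le_trans (leeD (ntc_le _) (ntc_le _)) _.
have sz (F : 'I_m -> 'rV[R]_1) : size [seq F e | e <- enum 'I_m] = m.
  by rewrite size_map size_enum_ord.
rewrite !sz -EFinD -mulrDr -splitr; exact: lexx.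
Qed.

End theta_upper.

Theorem corollary13 (R : realType) (m : nat) (hm : (3 <= m)%N) :
  NTC_inf R (theta m) = (m%:R * pi)%:E.
Proof.
apply/eqP; rewrite eq_le; apply/andP; split.
  apply: le_trans (flat_theta_NTC R m); apply: ereal_inf_lbound.
  by exists 1%N, (flat_theta R m).
apply: le_ereal_inf_tmp => _ [n [f [_ ->]]]; exact: theta_NTC_ge.
Qed.
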